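(* Let $\mathcal{A}=M_{n_1}\oplus\cdots\oplus M_{n_d}$, viewed as the block-diagonal subalgebra of $M_m$ with $m=n_1+\cdots+n_d$, and let $\tau$ be a completely positive map on $\mathcal{A}$ with $r(\tau)>0$. Then the canonical extension of the maximal part of $\tau$ equals the maximal part of the canonical extension of $\tau$: $\widetilde{\widehat{\tau}}=\widehat{\widetilde{\tau}}$. Moreover, for any Choi-Kraus decompositions $\widetilde{\tau}(X)=\sum_{i=1}^pA_i^*XA_i$ and $\widetilde{\widehat{\tau}}(X)=\sum_{j=1}^qB_j^*XB_j$ ($X\in M_m$), the vector space $\mathrm{span}\{B_1,\dots,B_q\}$ is a subalgebra of $M_m$ and is a non-zero ideal in the algebra generated by $A_1,\dots,A_p$.
   Context: $r(\tau)$ is the spectral radius. The canonical extension of a map $\sigma$ on $\mathcal{A}$ is $\widetilde{\sigma}=\iota\circ\sigma\circ\phi$, with $\iota:\mathcal{A}\hookrightarrow M_m$ the block-diagonal embedding and $\phi:M_m\to\mathcal{A}$ taking a block matrix to its block-diagonal part. For a positive map $\varphi$ on a finite dimensional $C^*$-algebra with $r(\varphi)>0$, its maximal part is $\widehat{\varphi}=\lim_{N\to\infty}\frac1N\sum_{n=1}^N\varphi^n/\|\varphi^n\|_\beta$, where $\beta$ is a Jordan basis of $\varphi$ and $\|\psi\|_\beta$ is the maximum modulus of the entries of the matrix of $\psi$ in $\beta$ (the limit exists, is independent of $\beta$, and is completely positive when $\varphi$ is). *)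

(* Defs.v *)
From HB Require Import structures.
From mathcomp Require Import all_boot all_order all_algebra.
From mathcomp Require Import reals complex.
Set Implicit Arguments. Unset Strict Implicit. Unset Printing Implicit Defensive.
Import Order.TTheory GRing.Theory Num.Theory.
Local Open Scope ring_scope.

Section Defs.
Variable C : numClosedFieldType.

Definition adjm p q (M : 'M[C]_(p, q)) : 'M[C]_(q, p) := map_mx Num.conj M^T.

Definition psd k (M : 'M[C]_k) : Prop :=
  forall v : 'cV[C]_k, 0 <= (adjm v *m M *m v) 0 0.

Section Block.
Variables (d : nat) (n : 'I_d -> nat).
Local Notation m := (\sum_(k < d) n k)%N.

Definition blockalg (X : 'M[C]_m) : Prop :=
  exists B : forall k : 'I_d, 'M[C]_(n k), X = mxdiag B.

Definition bdpart (X : 'M[C]_m) : 'M[C]_m := mxdiag (fun k => submxblock X k k).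

Definition canext (sigma : 'M[C]_m -> 'M[C]_m) : 'M[C]_m -> 'M[C]_m :=
  fun X => sigma (bdpart X).
End Block.

Section Maps.
Variable N : nat.
Local Notation Mat := 'M[C]_N.

Definition lin_on (S : Mat -> Prop) (f : Mat -> Mat) : Prop :=
  forall a X Y, S X -> S Y -> f (a *: X + Y) = a *: f X + f Y.

Definition lincomb D (c : 'I_D -> C) (b : 'I_D -> Mat) : Mat :=
  \sum_(i < D) c i *: b i.

Definition is_basis (S : Mat -> Prop) D (b : 'I_D -> Mat) : Prop :=
  [/\ forall i, S (b i),
      forall c, lincomb c b = 0 -> forall i, c i = 0 &
      forall X, S X -> exists c, X = lincomb c b].

Definition mx_in_basis D (b : 'I_D -> Mat) (f : Mat -> Mat) (M : 'M[C]_D) : Prop :=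
  forall j, f (b j) = \sum_(i < D) M i j *: b i.

Definition jordan_form D (J : 'M[C]_D) : Prop :=
  forall i j : 'I_D,
    [/\ j != i -> (j : nat) != i.+1 -> J i j = 0,
        (j : nat) = i.+1 -> J i j = 0 \/ J i j = 1 &
        (j : nat) = i.+1 -> J i j = 1 -> J i i = J j j].

Definition jordan_basis (S : Mat -> Prop) (f : Mat -> Mat) D (b : 'I_D -> Mat)
  (J : 'M[C]_D) : Prop :=
  [/\ is_basis S b, mx_in_basis b f J & jordan_form J].

Definition maxabs D (M : 'M[C]_D) : C :=
  \big[Num.max/0]_(i < D) \big[Num.max/0]_(j < D) `|M i j|.

Definition cvg_mx D (u : nat -> 'M[C]_D) (L : 'M[C]_D) : Prop :=
  forall e : C, 0 < e -> exists N0 : nat, forall K : nat, (N0 <= K)%N ->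
    forall i j, `|u K i j - L i j| < e.

Definition ces_avg D (P : nat -> 'M[C]_D) (K : nat) : 'M[C]_D :=
  K%:R^-1 *: \sum_(1 <= k < K.+1) ((maxabs (P k))^-1 *: P k).

Definition maxpart (S : Mat -> Prop) (f g : Mat -> Mat) : Prop :=
  [/\ lin_on S g,
      exists D (b : 'I_D -> Mat) J, jordan_basis S f b J &
      forall D (b : 'I_D -> Mat) J, jordan_basis S f b J ->
        forall P : nat -> 'M[C]_D, (forall k, mx_in_basis b (iter k f) (P k)) ->
        exists2 L, mx_in_basis b g L & cvg_mx (ces_avg P) L].

Definition eigval (S : Mat -> Prop) (f : Mat -> Mat) (l : C) : Prop :=
  exists X, [/\ S X, X != 0 & f X = l *: X].

Definition specrad (S : Mat -> Prop) (f : Mat -> Mat) (r : C) : Prop :=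
  (exists2 l, eigval S f l & `|l| = r) /\
  (forall l, eigval S f l -> `|l| <= r).

Definition cp_on (S : Mat -> Prop) (f : Mat -> Mat) : Prop :=
  forall k (X : 'I_k -> 'I_k -> Mat), (forall i j, S (X i j)) ->
    psd (mxblock (fun i j => X i j)) -> psd (mxblock (fun i j => f (X i j))).

Definition kraus (f : Mat -> Mat) p (K : 'I_p -> Mat) : Prop :=
  forall X, f X = \sum_(i < p) (adjm (K i) *m X *m K i).

Definition span_of q (B : 'I_q -> Mat) (X : Mat) : Prop :=
  exists c : 'I_q -> C, X = lincomb c B.

(* subalgebra (not necessarily unital) of M_N *)
Definition is_subalg (S : Mat -> Prop) : Prop :=
  [/\ S 0, forall a X Y, S X -> S Y -> S (a *: X + Y) &
      forall X Y, S X -> S Y -> S (X *m Y)].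

Definition gen_alg p (A : 'I_p -> Mat) (X : Mat) : Prop :=
  forall S, is_subalg S -> (forall i, S (A i)) -> S X.

Definition is_ideal_in (T V : Mat -> Prop) : Prop :=
  (forall X, V X -> T X) /\
  (forall a v, T a -> V v -> V (a *m v) /\ V (v *m a)).
End Maps.
End Defs.

Arguments blockalg {C d} n X.
Arguments bdpart {C d} n X.
Arguments canext {C d} n sigma X.

(* Main.v *)
Require Import Defs.
From HB Require Import structures.
From mathcomp Require Import all_boot all_order all_algebra.
From mathcomp Require Import boolp reals complex zify ring.
Import Order.TTheory GRing.Theory Num.Theory.
Local Open Scope ring_scope.
Set Implicit Arguments. Unset Strict Implicit. Unset Printing Implicit Defensive.

(** In a Jordan basis the entries of [J^k] are [C(k,u) l^(k-u)]; if [r] is the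
    largest modulus of a diagonal entry and [t + 1] the largest size of a block
    of modulus [r], then [||J^k|| = C(k,t) r^(k-t)] for large [k].  Hence the
    Cesaro means converge to the matrix [L] that marks the top right corners of
    the blocks of size [t + 1] and eigenvalue [r], and [J L = L J = r L].  The
    pair [(r, t)] is determined by the growth of [J^k] up to constant factors,
    so it is the same for [tau] and for its canonical extension [F]; therefore
    the normalisations agree and the maximal parts correspond.

    The span of the Kraus operators of a map is the annihilator of the zeros of
    its Choi form [z |-> sum_i |<z, K_i>|^2], which is linear in the map.  The
    Kraus operators of [F^k] lie in the algebra generated by the [A_i], hence so
    do the [B_j].  Since [F G = G F = r G] for the maximal part [G] of [F], the
    operators [B_j A_i] and [A_i B_j] lie in the span of the [B_j].  Finally
    [||F^k||] is bounded by a constant times the linear functional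
    [sum_{a,c} F^k(E_aa)_cc], so averaging gives [G <> 0]. *)

(** * Jordan normal form *)

Section JordanExistence.
Variable C : numClosedFieldType.

Definition jblock (l : C) s : 'M[C]_s :=
  \matrix_(i, j) (l *+ (i == j) + (j == i.+1 :> nat)%:R).

Lemma jordan_form_jblock l s : jordan_form (jblock l s).
Proof.
move=> i j; rewrite !mxE; split.
- by move=> /negPf ji /negPf ->; rewrite eq_sym ji mulr0n addr0.
- by move=> e; rewrite e eqxx -val_eqE /= e ltn_eqF // mulr0n add0r; right.
- by move=> e _; rewrite !eqxx !ltn_eqF.
Qed.

Lemma jordan_form_block_mx s k (J1 : 'M[C]_s) (J2 : 'M[C]_k) :
  jordan_form J1 -> jordan_form J2 -> jordan_form (block_mx J1 0 0 J2).
Proof.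
move=> h1 h2 i j.
case: (split_ordP i) => i' ->; case: (split_ordP j) => j' ->;
  rewrite ?(block_mxEul, block_mxEur, block_mxEdl, block_mxEdr) /=.
- have [a b c] := h1 i' j'; split=> [ne1 ne2|e|e]; [|exact: b|exact: c].
  by apply: a => //; apply: contra ne1 => /eqP ->.
- rewrite !mxE; split => // _; first by left.
  by move/eqP; rewrite eq_sym oner_eq0.
- rewrite !mxE; split => // e; have := ltn_ord j'; rewrite e; first by left.
  by move=> _ /eqP; rewrite eq_sym oner_eq0.
- have [a b c] := h2 i' j'; split => [ne1 ne2|e|e]; last 2 first.
  + by apply: b; apply/eqP; rewrite -(eqn_add2l s) e addnS.
  + by apply: c; apply/eqP; rewrite -(eqn_add2l s) e addnS.
  apply: a; first by apply: contra ne1 => /eqP ->.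
  by apply: contra ne2 => /eqP ->; rewrite addnS.
Qed.

(* With [p = (X - l)^s.+1 q] the minimal polynomial and [N = M - l], the vector
   [v] and the functional [u] are images of [q(M)] with [u N^s v <> 0] ;
   the vectors [N^i v] span a Jordan block, and the common kernel of the
   [u N^i] is an invariant complement. *)
Lemma jordan_chain n (M : 'M[C]_n.+1) :
  exists s l (X : 'M[C]_(n.+1, s.+1)) (Y : 'M[C]_(s.+1, n.+1)),
    [/\ M *m X = X *m jblock l s.+1, Y *m M = jblock l s.+1 *m Y
      & Y *m X \in unitmx].
Proof.
set p := mxminpoly M.
have p0 : p != 0 by rewrite monic_neq0 // mxminpoly_monic.
have /closed_rootP[l pl] : size p != 1.
  by rewrite size_mxminpoly; have := mxminpoly_nonconstant M; case: degree_mxminpoly.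
have [s [q]] := multiplicity_XsubC p l; rewrite p0 /= => ql pE.
case: s pE => [|s] pE; first by move: pl; rewrite pE expr0 mulr1 (negPf ql).
pose N := M - l%:M; pose Q := horner_mx M q.
have NE : horner_mx M ('X - l%:P) = N.
  by rewrite rmorphB /= horner_mx_X horner_mx_C.
have QN k : Q *m N ^+ k = N ^+ k *m Q.
  by rewrite -NE -rmorphXn; apply: comm_horner_mx2.
have QN0 : Q *m N ^+ s.+1 = 0.
  by rewrite -NE -rmorphXn /= -[_ *m _]/(_ * _) -rmorphM /= -pE mx_root_minpoly.
(* Otherwise the minimal polynomial [q (X - l)^s.+1] would divide [q^2 (X - l)^s], and [X - l] would
   divide [q]. *)
have QQN : Q *m N ^+ s *m Q != 0.
  rewrite -mulmxA -QN -NE -rmorphXn /= -![_ *m _]/(_ * _) -!rmorphM /= -dvd_mxminpoly.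
  rewrite -[mxminpoly M]/p [X in X %| _]pE exprSr mulrA [X in _ %| X]mulrC.
  rewrite dvdp_mul2l ?dvdp_XsubCl //.
  by move: p0; rewrite pE exprSr mulrA mulf_eq0 negb_or => /andP[].
have [v0 [u0 uv]] : exists v0 : 'cV[C]_n.+1, exists u0 : 'rV[C]_n.+1,
    (u0 *m (Q *m N ^+ s *m Q) *m v0) 0 0 != 0.
  have /matrix0Pn[i [j ij]] := QQN.
  exists (delta_mx j 0), (delta_mx 0 i).
  by rewrite -rowE -colE [col _ _ _ _]mxE [row _ _ _ _]mxE.
pose u := u0 *m Q; pose v := Q *m v0; pose c := (u *m N ^+ s *m v) 0 0.
have c0 : c != 0 by rewrite /c /u /v !mulmxA in uv *.
have uN k : (s < k)%N -> u *m N ^+ k = 0.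
  move=> sk; rewrite -(subnKC sk) exprD /u -mulmxA mulmxA.
  by rewrite -![_ * _]/(_ *m _) mulmxA -(mulmxA u0) QN0 mulmx0 mul0mx.
have Nv k : (s < k)%N -> N ^+ k *m v = 0.
  by move=> sk; rewrite /v mulmxA -QN -(subnKC sk) exprD -![_ * _]/(_ *m _) mulmxA QN0 !mul0mx.
have ME : M = N + l%:M by rewrite subrK.
(* Columns of [X] carry decreasing powers of [N] and rows of [Y] increasing ones, so that [N] acts
   on both by the same superdiagonal shift. *)
pose X := \matrix_(i < n.+1, j < s.+1) (N ^+ (s - j) *m v) i 0.
pose Y := \matrix_(i < s.+1, j < n.+1) (u *m N ^+ i) 0 j.
have colX j : col j X = N ^+ (s - j) *m v.
  by apply/colP => i; rewrite !mxE.
have rowY i : row i Y = u *m N ^+ i.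
  by apply/rowP => j; rewrite !mxE.
have JE : jblock l s.+1 = \matrix_(i < s.+1, j < s.+1) (j == i.+1 :> nat)%:R + l%:M.
  by apply/matrixP => i j; rewrite !mxE addrC.
have MX : N *m X = X *m \matrix_(i < s.+1, j < s.+1) (j == i.+1 :> nat)%:R.
  apply/matrixP => i j.
  have -> : (N *m X) i j = (N ^+ (s - j).+1 *m v) i 0.
    by rewrite exprS -[_ * _]/(_ *m _) -mulmxA -colX !mxE; apply: eq_bigr => k _; rewrite !mxE.
  rewrite [RHS]mxE; case: j => [[|j] lj] /=.
    by rewrite Nv ?subn0 // mxE big1 // => k _; rewrite !mxE mulr0.
  rewrite (bigD1 (Ordinal (ltnW lj))) //= big1 => [|k kj]; rewrite !mxE /= ?eqxx ?mulr1 ?addr0 ?subnSK //.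
  by rewrite eqSS eq_sym (negPf (kj : (k : nat) != j)) mulr0.
have YM : Y *m N = \matrix_(i < s.+1, j < s.+1) (j == i.+1 :> nat)%:R *m Y.
  apply/matrixP => i j.
  have -> : (Y *m N) i j = (u *m N ^+ i.+1) 0 j.
    by rewrite exprSr -[_ * _]/(_ *m _) mulmxA -rowY !mxE; apply: eq_bigr => k _; rewrite !mxE.
  rewrite [RHS]mxE; case: (ltnP i.+1 s.+1) => li.
    rewrite (bigD1 (Ordinal li)) //= big1 => [|k ki]; rewrite !mxE /= ?eqxx ?mul1r ?addr0 //.
    by rewrite (negPf (ki : (k : nat) != i.+1)) mul0r.
  rewrite uN // mxE big1 // => k _; rewrite !mxE ltn_eqF ?mul0r //.
  exact: leq_trans (ltn_ord k) li.
exists s, l, X, Y; split.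
- by rewrite ME JE mulmxDl mulmxDr MX scalar_mxC.
- by rewrite ME JE mulmxDl mulmxDr YM scalar_mxC.
(* [Y X] is upper triangular, since the exponent exceeds [s] when [j < i], and its diagonal entries
   all equal [c]. *)
have YXE i j : (Y *m X) i j = (u *m N ^+ (i + (s - j)) *m v) 0 0.
  rewrite exprD -[_ * _]/(_ *m _) mulmxA -rowY -mulmxA -colX !mxE.
  by apply: eq_bigr => k _; rewrite !mxE.
rewrite -unitmx_tr unitmxE det_trig.
  rewrite unitfE; apply/prodf_neq0 => i _; rewrite mxE YXE subnKC //.
  by rewrite -ltnS.
apply/is_trig_mxP => i j ij; rewrite mxE YXE uN ?mul0mx ?mxE //.
by have := ltn_ord j; move: ij => /=; lia.
Qed.

(** The kernel of [Y] is [M]-invariant because [Y M = J2 Y]. Invertibility of [Y X] gives [Y] full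
    rank, which fixes the dimension of the kernel, and makes the kernel meet the range of [X]
    trivially. Transposes appear because kernels are row spaces. *)
Lemma invariant_complement n s (M : 'M[C]_n) (J1 J2 : 'M[C]_s)
    (X : 'M[C]_(n, s)) (Y : 'M[C]_(s, n)) :
  M *m X = X *m J1 -> Y *m M = J2 *m Y -> Y *m X \in unitmx ->
  exists k (Z : 'M[C]_(n, k)) (M2 : 'M[C]_k),
    [/\ n = (s + k)%N, M *m Z = Z *m M2 & row_free (row_mx X Z)^T].
Proof.
move=> MX YM YX.
have rY : \rank Y = s.
  apply/eqP; rewrite eqn_leq rank_leq_row -{1}(mxrank_unit YX).
  exact: mxrankM_maxl.
pose Z := (row_base (kermx Y^T))^T.
have sn : (s <= n)%N by rewrite -rY rank_leq_col.
have YZ : Y *m Z = 0.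
  apply/(can_inj (@trmxK _ _ _)); rewrite trmx_mul trmxK trmx0.
  by apply/sub_kermxP; rewrite eq_row_base.
have /submxP[D DE] : ((M *m Z)^T <= row_base (kermx Y^T))%MS.
  rewrite eq_row_base; apply/sub_kermxP.
  by rewrite -trmx_mul mulmxA YM -mulmxA YZ mulmx0 trmx0.
exists _, Z, D^T; split.
- by rewrite mxrank_ker mxrank_tr rY subnKC.
- by apply/(can_inj (@trmxK _ _ _)); rewrite DE trmx_mul !trmxK.
apply: inj_row_free => v; rewrite tr_row_mx -[v]hsubmxK mul_row_col trmxK.
set a := lsubmx v; set b := rsubmx v => ab0.
have a0 : a = 0.
  have : (a *m X^T + b *m row_base (kermx Y^T)) *m Y^T = 0 by rewrite ab0 mul0mx.
  have /eqP/sub_kermxP bY : b *m row_base (kermx Y^T) *m Y^T == 0.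
    by rewrite -mulmxA -[row_base _]trmxK -trmx_mul YZ trmx0 mulmx0.
  rewrite mulmxDl (sub_kermxP bY) addr0 -mulmxA -trmx_mul => h.
  by rewrite -[a](mulmxK (_ : (Y *m X)^T \in unitmx)) ?unitmx_tr // h mul0mx.
move: ab0; rewrite a0 mul0mx add0r => b0.
have -> : b = 0 by apply: (row_free_inj (row_base_free (kermx Y^T))); rewrite b0 mul0mx.
by rewrite row_mx0.
Qed.

(** The size [s + k] of a decomposed space equals [n] only propositionally; the equation is
    substituted here to make [P] square. *)
Lemma similar_square n m (M : 'M[C]_n) (P : 'M[C]_(n, m)) (J : 'M[C]_m) :
  n = m -> M *m P = P *m J -> row_free P^T -> jordan_form J ->
  exists P J, [/\ P \in unitmx, M *m P = P *m J & jordan_form J].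
Proof.
by move=> e; subst m; rewrite row_free_unit unitmx_tr => MP uP jJ; exists P, J.
Qed.

(** Strong induction on the size: one Jordan block splits off, and the induction hypothesis applies
    to the action of [M] on the invariant complement. *)
Theorem jordan_exists n (M : 'M[C]_n) :
  exists P J, [/\ P \in unitmx, M *m P = P *m J & jordan_form J].
Proof.
elim: n {-2}n (leqnn n) M => [|n0 IH] [|n] // ln M;
  try by exists 1%:M, 0; split=> //; [rewrite unitmx1|rewrite [LHS]flatmx0 [RHS]flatmx0|case].
have [s [l [X [Y [MX YM YX]]]]] := jordan_chain M.
have [k [Z [M2 [nE MZ rf]]]] := invariant_complement MX YM YX.
have [|P2 [J2 [uP MP jJ]]] := IH k _ M2; first by lia.
have jB := jordan_form_block_mx (@jordan_form_jblock l s.+1) jJ.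
pose P := row_mx X (Z *m P2); pose J := block_mx (jblock l s.+1) 0 0 J2.
have MPJ : M *m P = P *m J.
  by rewrite mul_mx_row MX mulmxA MZ -mulmxA MP mul_row_block !mulmx0 addr0 add0r mulmxA.
have {rf} rf : row_free P^T.
  have -> : P^T = block_mx 1%:M 0 0 P2^T *m (row_mx X Z)^T.
    by rewrite !tr_row_mx trmx_mul mul_block_col !mul0mx mul1mx addr0 add0r.
  rewrite /row_free mxrankMfree // -/(row_free _) row_free_unit.
  by rewrite unitmxE det_ublock det1 mul1r det_tr -unitmxE.
exact: similar_square nE MPJ rf jB.
Qed.
End JordanExistence.

(** * Convergence of sequences and of averages *)

Lemma eventually_forall (T : finType) (P : T -> nat -> Prop) :
  (forall i, exists N0, forall k, (N0 <= k)%N -> P i k) ->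
  exists N0, forall k, (N0 <= k)%N -> forall i, P i k.
Proof.
move=> /fin_all_exists[f hf]; exists (\max_i f i)%N => k hk i.
by apply: hf; apply: leq_trans hk; apply: leq_bigmax.
Qed.

Section Sequences.
Variable C : numClosedFieldType.
Implicit Types (u v : nat -> C) (l : C).

Definition cvgs u l := forall e : C, 0 < e ->
  exists N0 : nat, forall k, (N0 <= k)%N -> `|u k - l| < e.

(** The sum starts at 1 as in [ces_avg], so identities valid only for positive [k] can be used under
    the average. *)
Definition avg u (K : nat) : C := K%:R^-1 * \sum_(1 <= k < K.+1) u k.

Lemma cvgs_eventually u v l N0 :
  (forall k, (N0 <= k)%N -> u k = v k) -> cvgs v l -> cvgs u l.
Proof.
move=> uv vl e /vl[N1 h]; exists (maxn N0 N1) => k; rewrite geq_max => /andP[k0 k1].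
by rewrite uv // h.
Qed.

Lemma cvgs_ext u v l : u =1 v -> cvgs v l -> cvgs u l.
Proof. by move=> uv; apply: (@cvgs_eventually _ _ _ 0%N) => k _. Qed.

Lemma cvgs_cst l : cvgs (fun=> l) l.
Proof. by move=> e e0; exists 0%N => k _; rewrite subrr normr0. Qed.

Lemma cvgsD u v l l' : cvgs u l -> cvgs v l' -> cvgs (fun k => u k + v k) (l + l').
Proof.
move=> ul vl e e0; have e2 : 0 < e / 2 by rewrite divr_gt0.
have [[N0 h0] [N1 h1]] := (ul _ e2, vl _ e2).
exists (maxn N0 N1) => k; rewrite geq_max => /andP[k0 k1].
rewrite opprD addrACA (splitr e); apply: le_lt_trans (ler_normD _ _) _.
by rewrite ltrD // ?h0 ?h1.
Qed.

Lemma cvgsMl c u l : cvgs u l -> cvgs (fun k => c * u k) (c * l).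
Proof.
move=> ul; have [->|c0] := eqVneq c 0.
  by rewrite mul0r; apply: (cvgs_ext _ (cvgs_cst 0)) => k; rewrite mul0r.
move=> e e0; have [|N0 h] := ul (e / `|c|); first by rewrite divr_gt0 ?normr_gt0.
by exists N0 => k /h; rewrite ltr_pdivlMr ?normr_gt0 // mulrC -normrM mulrBr.
Qed.

Lemma cvgs_sum (T : finType) (u : T -> nat -> C) (l : T -> C) :
  (forall i, cvgs (u i) (l i)) -> cvgs (fun k => \sum_i u i k) (\sum_i l i).
Proof.
move=> h; elim: (index_enum T) => [|i s IH].
  by rewrite big_nil; apply: (cvgs_ext _ (cvgs_cst 0)) => k; rewrite big_nil.
rewrite big_cons; apply: (cvgs_ext _ (cvgsD (h i) IH)) => k.
by rewrite big_cons.
Qed.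

Lemma cvgs_le0 u v N0 :
  (forall k, (N0 <= k)%N -> `|u k| <= v k) -> cvgs v 0 -> cvgs u 0.
Proof.
move=> uv v0 e /v0[N1 h]; exists (maxn N0 N1) => k; rewrite geq_max => /andP[k0 k1].
rewrite subr0; apply: le_lt_trans (uv _ k0) _.
have := h _ k1; rewrite subr0 ger0_norm //.
by apply: le_trans (uv _ k0).
Qed.

Lemma cvgs_cst_eq l l' : cvgs (fun=> l) l' -> l = l'.
Proof.
move=> h; apply/eqP; rewrite -subr_eq0 -normr_eq0; apply/negP => /negP n0.
have [|N0 /(_ N0 (leqnn _))] := h `|l - l'|; first by rewrite lt_def n0 normr_ge0.
by rewrite ltxx.
Qed.

Lemma avgD u v K : avg (fun k => u k + v k) K = avg u K + avg v K.
Proof. by rewrite /avg big_split mulrDr. Qed.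

Lemma avgMl c u K : avg (fun k => c * u k) K = c * avg u K.
Proof. by rewrite /avg -mulr_sumr mulrCA. Qed.

Lemma avg_sum (T : finType) (u : T -> nat -> C) K :
  avg (fun k => \sum_i u i k) K = \sum_i avg (u i) K.
Proof. by rewrite /avg exchange_big mulr_sumr. Qed.

Lemma avg_eq u v K : (forall k, (0 < k)%N -> u k = v k) -> avg u K = avg v K.
Proof.
move=> uv; rewrite /avg; congr (_ * _); apply: eq_big_nat => k /andP[k0 _].
exact: uv.
Qed.

Lemma avg_cst c K : (0 < K)%N -> avg (fun=> c) K = c.
Proof.
move=> K0; rewrite /avg big_const_nat subn1 /= iter_addr_0 -[c *+ K]mulr_natl mulKf //.
by rewrite pnatr_eq0 -lt0n.
Qed.

Lemma avg_le u v K : (forall k, (0 < k)%N -> u k <= v k) -> avg u K <= avg v K.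
Proof.
move=> uv; rewrite /avg ler_wpM2l ?invr_ge0 ?ler0n //.
by rewrite !big_nat; apply: ler_sum => k /andP[k0 _]; apply: uv.
Qed.

Lemma ler_norm_avg u K : `|avg u K| <= avg (fun k => `|u k|) K.
Proof.
rewrite /avg normrM ger0_norm ?invr_ge0 ?ler0n // ler_wpM2l ?invr_ge0 ?ler0n //.
exact: ler_norm_sum.
Qed.

(** In a general [numClosedFieldType] the sequence [1/k] need not tend to 0; for [R[i]] the
    hypothesis is [complex_archimedean]. *)
Hypothesis archC : forall x : C, exists n : nat, `|x| < n%:R.

Lemma cvgs_inv_nat : cvgs (fun k => k%:R^-1) 0.
Proof.
move=> e e0; have [N0] := archC e^-1; rewrite gtr0_norm ?invr_gt0 // => hN.
exists N0 => k Nk; rewrite subr0.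
have lk : e^-1 < k%:R by apply: lt_le_trans hN _; rewrite ler_nat.
have k0 : 0 < k%:R :> C by apply: lt_trans lk; rewrite invr_gt0.
by rewrite ger0_norm ?invr_ge0 ?ler0n // invf_plt // posrE.
Qed.

Lemma cvgs_avg_bounded u b :
  (forall K, `|\sum_(1 <= k < K.+1) u k| <= b) -> cvgs (avg u) 0.
Proof.
move=> ub; have /(cvgsMl b) := cvgs_inv_nat; rewrite mulr0.
apply: (@cvgs_le0 _ _ 0%N) => k _; rewrite normrM mulrC.
by rewrite [X in _ * X]ger0_norm ?invr_ge0 ?ler0n // ler_wpM2r ?invr_ge0 ?ler0n.
Qed.

Lemma cvgs_avg0 u : cvgs u 0 -> cvgs (avg u) 0.
Proof.
move=> u0 e e0; have e2 : 0 < e / 2 by rewrite divr_gt0.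
have [N0 hN] := u0 _ e2.
(* The initial part [w] has bounded partial sums, so its average vanishes; the tail [z] is bounded
   by [e / 2] throughout. *)
pose w k := if (k < N0)%N then u k else 0.
pose z k := if (k < N0)%N then 0 else u k.
have [K0 hK] : exists K0, forall K, (K0 <= K)%N -> `|avg w K| < e / 2.
  have [|K0 hK] := @cvgs_avg_bounded w (\sum_(1 <= k < N0) `|w k|) _ _ e2.
    move=> K; apply: le_trans (ler_norm_sum _ _ _) _.
    have [KN|NK] := leqP K.+1 N0.
      by rewrite [leRHS](big_cat_nat (ltn0Sn K) KN) /= lerDl sumr_ge0.
    have [N00|N00] := leqP N0 1.
      rewrite [X in _ <= X]big_geq // big_nat big1 // => k /andP[k1 _].
      by rewrite /w ltnNge (leq_trans N00) //= normr0.
    rewrite (big_cat_nat (ltnW N00) (ltnW NK)) /= gerDl.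
    rewrite big_nat big1 // => k /andP[k1 _].
    by rewrite /w ltnNge k1 normr0.
  by exists K0 => K /hK; rewrite subr0.
exists (maxn 1 K0) => K; rewrite geq_max => /andP[K1 /hK wK]; rewrite subr0.
have -> : avg u K = avg w K + avg z K.
  rewrite -avgD; apply: avg_eq => k _; rewrite /w /z.
  by case: ifP; rewrite ?addr0 ?add0r.
rewrite (splitr e); apply: le_lt_trans (ler_normD _ _) _.
rewrite ltr_leD //; apply: le_trans (ler_norm_avg _ _) _.
rewrite -[leRHS](avg_cst _ K1); apply: avg_le => k _; rewrite /z.
case: ifP => [_|/negbT]; first by rewrite normr0 ltW.
by rewrite -leqNgt => /hN; rewrite subr0 => /ltW.
Qed.

Lemma cvgs_avg u l : cvgs u l -> cvgs (avg u) l.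
Proof.
move=> ul; have /cvgs_avg0 h : cvgs (fun k => u k - l) 0.
  by rewrite -(subrr l); apply: cvgsD => //; apply: cvgs_cst.
rewrite -[l]addr0; apply: (@cvgs_eventually _ _ _ 1) (cvgsD (cvgs_cst l) h) => K K0.
by rewrite avgD avg_cst // addrC subrK.
Qed.

(** The geometric sums telescope and stay bounded by [2 / |z - 1|]. This removes the eigenvalues of
    modulus [r] other than [r] from the Cesaro limit. *)
Lemma cvgs_avg_geometric z : `|z| = 1 -> z != 1 -> cvgs (avg (fun k => z ^+ k)) 0.
Proof.
move=> z1 zn1; apply: (@cvgs_avg_bounded _ (2 / `|z - 1|)) => K.
have zB : z - 1 != 0 by rewrite subr_eq0.
have -> : \sum_(1 <= k < K.+1) z ^+ k = (z ^+ K.+1 - z) / (z - 1).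
  apply: (mulIf zB); rewrite mulfVK // mulr_suml.
  under eq_bigr do rewrite mulrBr mulr1 -exprSr.
  by rewrite telescope_sumr // expr1.
rewrite normrM normfV ler_wpM2r ?invr_ge0 //.
by apply: le_trans (ler_normB _ _) _; rewrite normrX z1 expr1n.
Qed.

(** With [z^-1 = 1 + h], Bernoulli's inequality bounds [z^k] by [1 / (h k)]. *)
Lemma cvgs_geometric (z : C) : 0 <= z -> z < 1 -> cvgs (fun k => z ^+ k) 0.
Proof.
move=> z0 z1; have [->|zn0] := eqVneq z 0.
  apply: (@cvgs_eventually _ _ _ 1) (cvgs_cst 0) => -[//|k] _.
  by rewrite expr0n.
have zp : 0 < z by rewrite lt_def zn0.
have [h h0 zE] : exists2 h, 0 < h & z^-1 = 1 + h.
  by exists (z^-1 - 1); rewrite ?subr_gt0 ?invf_gt1 // addrC subrK.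
have /(cvgsMl h^-1) := cvgs_inv_nat; rewrite mulr0.
apply: (@cvgs_le0 _ _ 1) => k k0.
rewrite ger0_norm ?exprn_ge0 // -invfM -[z]invrK exprVn zE.
have kp : 0 < k%:R :> C by rewrite ltr0n.
have bern : h * k%:R <= (1 + h) ^+ k.
  elim: (k) => [|m IH]; first by rewrite mulr0 expr0 ler01.
  rewrite exprS mulrDl mul1r -addn1 natrD mulrDr mulr1 lerD // ler_peMr ?(ltW h0) //.
  by apply: exprn_ege1; rewrite lerDl ltW.
by rewrite lef_pV2 // posrE ?mulr_gt0 ?exprn_gt0 // ltr_wpDl ?ler01.
Qed.
End Sequences.

(** * Powers of a Jordan matrix *)

Lemma bin_mono_half k u t : (u <= t)%N -> (2 * t <= k)%N -> ('C(k, u) <= 'C(k, t))%N.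
Proof.
elim: t => [|t IH]; first by rewrite leqn0 => /eqP->.
rewrite leq_eqVlt ltnS => /orP[/eqP->//|ut] tk.
apply: leq_trans (IH ut _) _; first by lia.
have := mul_bin_left k t; rewrite -(leq_pmul2l (ltn0Sn t)) => ->.
by rewrite leq_mul2r; apply/orP; right; lia.
Qed.

(** Since [(k - u) C(k,u) = (u + 1) C(k,u+1)] and [k <= 2 (k - u)], lowering the index of a binomial
    costs a factor of order [k]. *)
Lemma bin_lower_order k u t :
  (u < t)%N -> (2 * t <= k)%N -> ('C(k, u) * k <= 2 * t * 'C(k, t))%N.
Proof.
move=> ut tk; have := mul_bin_left k u.
have := bin_mono_half ut tk; have : (k <= 2 * (k - u))%N by lia.
nia.
Qed.

Section Growth.
Variable C : numClosedFieldType.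
Hypothesis archC : forall x : C, exists n : nat, `|x| < n%:R.

(** The entry on the [u]-th superdiagonal of the [k]-th power of a Jordan block with eigenvalue [x].
    For [k < u] the exponent is truncated, but the binomial is 0. *)
Definition growth (x : C) (u k : nat) : C := 'C(k, u)%:R * x ^+ (k - u).

Lemma norm_growth x u k : `|growth x u k| = growth `|x| u k.
Proof. by rewrite /growth normrM normrX normr_nat. Qed.

Lemma growth_gt0 r t k : 0 < r -> (t <= k)%N -> 0 < growth r t k.
Proof. by move=> r0 tk; rewrite /growth mulr_gt0 ?exprn_gt0 ?ltr0n ?bin_gt0. Qed.

Lemma growth_ge0 r t k : 0 <= r -> 0 <= growth r t k.
Proof. by move=> r0; rewrite /growth mulr_ge0 ?exprn_ge0. Qed.

(** The left side is one term of the binomial expansion of the right side. *)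
Lemma growth_le_exp rho d u k :
  0 <= rho -> 0 <= d -> growth rho u k * d ^+ u <= (rho + d) ^+ k.
Proof.
move=> rho0 d0; rewrite /growth; have [uk|ku] := leqP u k; last first.
  by rewrite bin_small // !mul0r exprn_ge0 // addr_ge0.
rewrite exprDn (bigD1 (inord u)) //= inordK ?ltnS // -mulrA mulr_natl lerDl.
by apply: sumr_ge0 => i _; rewrite mulrn_wge0 // mulr_ge0 ?exprn_ge0.
Qed.

(** If [|x| < r], the midpoint [s] of the two gives a bound by a multiple of [(s / r)^k]. If the
    moduli agree and [u < t], the quotient of the binomials is of order [1/k]. *)
Lemma growth_dominated (x r : C) u t :
    0 < r -> `|x| < r \/ `|x| = r /\ (u < t)%N ->
  cvgs (fun k => growth x u k / growth r t k) 0.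
Proof.
move=> r0 [xr|[xr ut]].
  pose s := (`|x| + r) / 2; pose d := s - `|x|.
  have [xs sr'] := midf_lt xr.
  have d0 : 0 < d by rewrite subr_gt0.
  have sr : s / r < 1 by rewrite ltr_pdivrMr // mul1r.
  have sp : 0 <= s by apply: le_trans (ltW xs).
  have s0 : 0 <= s / r by rewrite divr_ge0 // ltW.
  have := cvgsMl (r ^+ t / d ^+ u) (cvgs_geometric archC s0 sr); rewrite mulr0.
  apply: (@cvgs_le0 _ _ _ t) => k tk.
  rewrite normrM normfV norm_growth (ger0_norm (growth_ge0 _ _ (ltW r0))).
  rewrite ler_pdivrMr ?growth_gt0 //.
  have h1 : growth `|x| u k <= s ^+ k / d ^+ u.
    rewrite ler_pdivlMr ?exprn_gt0 //.
    by apply: le_trans (growth_le_exp _ _ _ (ltW d0)) _; rewrite // /d addrC subrK.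
  apply: le_trans h1 _.
  have -> : r ^+ t / d ^+ u * (s / r) ^+ k * growth r t k
          = s ^+ k / d ^+ u * 'C(k, t)%:R.
    rewrite /growth expr_div_n -[in r ^+ k](subnK tk) exprD; field.
    by rewrite !expf_neq0 ?gt_eqF.
  by rewrite ler_peMr ?divr_ge0 ?exprn_ge0 ?(ltW d0) // ler1n bin_gt0.
have := cvgsMl ((2 * t)%:R * r ^+ (t - u)) (cvgs_inv_nat archC); rewrite mulr0.
apply: (@cvgs_le0 _ _ _ (2 * t).+1) => k tk.
rewrite normrM normfV norm_growth (ger0_norm (growth_ge0 _ _ (ltW r0))) xr.
have kt : (t <= k)%N by lia.
rewrite ler_pdivrMr ?growth_gt0 // /growth.
have -> : (k - u = (t - u) + (k - t))%N by lia.
rewrite exprD.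
have -> : (2 * t)%:R * r ^+ (t - u) / k%:R * ('C(k, t)%:R * r ^+ (k - t)) = ((2 * t)%:R * 'C(k, t)%:R / k%:R) * (r ^+ (t - u) * r ^+ (k - t)) by ring.
rewrite ler_wpM2r ?mulr_ge0 ?exprn_ge0 ?(ltW r0) //.
rewrite ler_pdivlMr ?ltr0n; last by lia.
by rewrite -!natrM ler_nat bin_lower_order // ltnW.
Qed.
End Growth.

Section JordanPower.
Variable C : numClosedFieldType.
Variables (D : nat) (J : 'M[C]_D).
Hypothesis jJ : jordan_form J.

(** The indices lie in one Jordan block, in this order. As [jordan_form] does not list the blocks,
    they are read off from the runs of ones on the superdiagonal. *)
Definition chained (i j : 'I_D) : bool := (i <= j)%N &&
  [forall p : 'I_D, forall q : 'I_D,
    [&& (q == p.+1 :> nat), (i <= p)%N & (q <= j)%N] ==> (J p q == 1)].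

Lemma chainedP (i j : 'I_D) : reflect ((i <= j)%N /\ forall p q : 'I_D, q = p.+1 :> nat ->
   (i <= p)%N -> (q <= j)%N -> J p q = 1) (chained i j).
Proof.
apply: (iffP andP) => -[ij h]; split=> //.
  move=> p q qp ip qj; move/forallP/(_ p)/forallP/(_ q): h.
  by rewrite ip qj !andbT qp eqxx => /eqP.
apply/forallP => p; apply/forallP => q; apply/implyP => /and3P[/eqP a b c].
by apply/eqP; apply: h.
Qed.

Lemma chained_refl i : chained i i.
Proof. by apply/chainedP; split=> // p q qp ip; lia. Qed.

Lemma chained_consr (i p q : 'I_D) : q = p.+1 :> nat -> (i <= p)%N ->
  chained i q = chained i p && (J p q == 1).
Proof.
move=> qp ip; apply/chainedP/andP => [[iq h]|[/chainedP[_ h] /eqP pq]].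
  by split; [apply/chainedP; split=> // a b ab ia bp; apply: h=> //; lia|rewrite h].
split=> [|a b ab ia]; first by lia.
rewrite leq_eqVlt => /orP[/eqP/val_inj bq|]; last by rewrite qp ltnS => bp; apply: h.
by rewrite bq -pq; congr (J _ _); apply: ord_inj; move: ab; rewrite bq qp => -[].
Qed.

Lemma chained_consl (p q j : 'I_D) : q = p.+1 :> nat -> (q <= j)%N ->
  chained p j = (J p q == 1) && chained q j.
Proof.
move=> qp qj; apply/chainedP/andP => [[iq h]|[/eqP pq /chainedP[_ h]]].
  by split; [rewrite h|apply/chainedP; split=> // a b ab ia bp; apply: h=> //; lia].
split=> [|a b ab]; first by lia.
rewrite leq_eqVlt => /orP[/eqP/val_inj pa|]; last by rewrite -qp => bp; apply: h.
by rewrite -pa -pq => _; congr (J _ _); apply: ord_inj; rewrite ab -pa qp.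
Qed.

Lemma chained_diag (i j : 'I_D) : chained i j -> J i i = J j j.
Proof.
move=> ij; have := ij; case/chainedP => + _; move: ij.
elim: {j}(j : nat) {-2}j (erefl (j : nat)) => [|n IH] j jn ij.
  by rewrite jn leqn0 => /eqP i0; congr (J _ _); apply: ord_inj; rewrite i0 jn.
rewrite leq_eqVlt => /orP[/eqP/val_inj->//|]; rewrite jn ltnS => ni.
have np : (n < D)%N by rewrite -jn ltnW.
move: ij; rewrite (@chained_consr i (Ordinal np) j) // => /andP[ip /eqP pj].
rewrite (IH (Ordinal np)) //.
by have [_ _ ->] := jJ (Ordinal np) j.
Qed.

(** The remaining sum has at most one term; keeping it as a sum avoids a separate case for the first
    column. *)
Lemma jordan_mulr (X : 'M[C]_D) i j :
  (X *m J) i j = X i j * J j j + \sum_(p : 'I_D | j == p.+1 :> nat) X i p * J p j.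
Proof.
rewrite mxE (bigID (fun p : 'I_D => p == j)) /= big_pred1_eq; congr (_ + _).
rewrite (bigID (fun p : 'I_D => j == p.+1 :> nat)) /= addrC big1 ?add0r => [|p /andP[pj jp]].
  by apply: eq_bigl => p; case: (eqVneq p j) => [->|_] //=; lia.
by have [->] := jJ p j; rewrite ?mulr0 // eq_sym.
Qed.

Lemma jordan_mull (X : 'M[C]_D) i j :
  (J *m X) i j = J i i * X i j + \sum_(p : 'I_D | p == i.+1 :> nat) J i p * X p j.
Proof.
rewrite mxE (bigID (fun p : 'I_D => p == i)) /= big_pred1_eq; congr (_ + _).
rewrite (bigID (fun p : 'I_D => p == i.+1 :> nat)) /= addrC big1 ?add0r => [|p /andP[pj jp]].
  by apply: eq_bigl => p; case: (eqVneq p i) => [->|_] //=; lia.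
by have [->] := jJ i p; rewrite ?mul0r.
Qed.

(** Induction on [k], where the step is Pascal's rule along a chain and a zero on the superdiagonal
    ends the chain. *)
Lemma jordan_pow k i j : (J ^+ k) i j =
  if chained i j then growth (J i i) (j - i) k else 0.
Proof.
elim: k i j => [|k IH] i j.
  rewrite expr0 mxE; have [<-|ij] := eqVneq i j.
    by rewrite chained_refl /growth subnn bin0 expr0 mulr1.
  case: ifP => // /chainedP[le _]; rewrite /growth bin_small ?mul0r //.
  by rewrite subn_gt0 ltn_neqAle le andbT; apply: contra ij.
rewrite exprSr -[_ * _]/(_ *m _) jordan_mulr IH.
have [ji|ij] := ltnP j i.
  rewrite !ifF; try by apply/negP => /chainedP[]; lia.
  rewrite mul0r add0r big1 // => p /eqP jp; rewrite IH ifF ?mul0r //.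
  by apply/negP => /chainedP[]; lia.
have [e|ne] := eqVneq i j.
  subst j; rewrite chained_refl big1 ?addr0 => [|p /eqP ip].
    by rewrite /growth subnn !bin0 !mul1r !subn0 exprSr.
  by rewrite IH ifF ?mul0r //; apply/negP => /chainedP[]; lia.
have {ne}ij : (i < j)%N by rewrite ltn_neqAle ij andbT.
have jp : j = j.-1.+1 :> nat by lia.
have pD : (j.-1 < D)%N by have := ltn_ord j; lia.
pose p := Ordinal pD.
rewrite (big_pred1 p) => [|q]; last by apply/eqP/eqP => [jq|->] //; apply: ord_inj; rewrite /= jq.
have ip : (i <= p)%N by rewrite /=; lia.
rewrite IH (@chained_consr i p j) //.
have [cip|] := boolP (chained i p); last by rewrite !mul0r add0r.
have [e1|ne1] := eqVneq (J p j) 1; last first.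
  have [_ [//|->|e]] := jJ p j; rewrite ?mul0r ?add0r ?mulr0 //.
  by rewrite e eqxx in ne1.
have [_ _ /(_ jp e1) ppjj] := jJ p j.
rewrite /= -ppjj -(chained_diag cip) e1 mulr1 /growth.
have -> : (j - i = (p - i).+1)%N by rewrite /=; lia.
rewrite binS natrD mulrDl subSS; congr (_ + _).
(* Beyond the range where the exponents add up, truncated subtraction is harmless because the
   binomial vanishes. *)
have [lt|ge] := ltnP (p - i) k; last by rewrite bin_small ?ltnS // !mul0r.
by rewrite -mulrA -exprSr subnSK.
Qed.
End JordanPower.

(** * Normalised averages of the powers of a Jordan matrix *)

Section MaxAbs.
Variable C : numClosedFieldType.

(** The order of [C] is partial, so [Num.max] has its usual properties only on comparable elements,
    here non-negative ones. *)
Lemma max_ge0_cases (a b : C) : 0 <= a -> 0 <= b ->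
  [/\ a <= Num.max a b, b <= Num.max a b & Num.max a b = a \/ Num.max a b = b].
Proof.
move=> a0 b0; rewrite /Num.max.
have [ab|ba] := real_ltP (ger0_real a0) (ger0_real b0).
  by split=> //; [exact: ltW|right].
by split=> //; left.
Qed.

Lemma bigmax_ge0_cases (T : finType) (F : T -> C) : (forall i, 0 <= F i) ->
  [/\ 0 <= \big[Num.max/0]_i F i, forall i, F i <= \big[Num.max/0]_i F i
    & \big[Num.max/0]_i F i = 0 \/ exists i, \big[Num.max/0]_i F i = F i].
Proof.
move=> F0.
suff [a b c] : let m := \big[Num.max/0]_(i <- index_enum T) F i in
  [/\ 0 <= m, forall i, i \in index_enum T -> F i <= m & m = 0 \/ exists i, m = F i].
  by split=> // i; apply: b; rewrite mem_index_enum.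
elim: (index_enum T) => [|i s [IH0 IHs IHe]] /=; rewrite ?big_nil ?big_cons.
  by split=> //; left.
have [a b c] := max_ge0_cases (F0 i) IH0.
split=> [|j|]; first exact: le_trans b.
  rewrite inE => /orP[/eqP->//|/IHs js]; exact: le_trans b.
by case: c => ->; [right; exists i|].
Qed.

Variable D : nat.
Implicit Types M : 'M[C]_D.

Let row_max_ge0 M i : 0 <= \big[Num.max/0]_(j < D) `|M i j|.
Proof. by case: (bigmax_ge0_cases (fun j => normr_ge0 (M i j))). Qed.

Lemma maxabs_ge0 M : 0 <= maxabs M.
Proof. by case: (bigmax_ge0_cases (row_max_ge0 M)). Qed.

Lemma maxabs_ge M i j : `|M i j| <= maxabs M.
Proof.
have [_ /(_ i) h _] := bigmax_ge0_cases (row_max_ge0 M).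
by apply: le_trans h; case: (bigmax_ge0_cases (fun j => normr_ge0 (M i j))).
Qed.

Lemma maxabs_le M c : 0 <= c -> (forall i j, `|M i j| <= c) -> maxabs M <= c.
Proof.
move=> c0 h; rewrite /maxabs; have [_ _ [->|[i ->]]] := bigmax_ge0_cases (row_max_ge0 M) => //.
by have [_ _ [->|[j ->]]] := bigmax_ge0_cases (fun j => normr_ge0 (M i j)).
Qed.
End MaxAbs.

Section JordanLimit.
Variable C : numClosedFieldType.
Hypothesis archC : forall x : C, exists n : nat, `|x| < n%:R.

Lemma cvg_mxP D (u : nat -> 'M[C]_D) (L : 'M[C]_D) :
  (forall i j, cvgs (fun K => u K i j) (L i j)) -> cvg_mx u L.
Proof.
move=> h e e0; have [|N0 hN] := @eventually_forall ('I_D * 'I_D)%type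
    (fun p k => `|u k p.1 p.2 - L p.1 p.2| < e).
  by move=> p; have [N0 hN] := h p.1 p.2 e e0; exists N0.
by exists N0 => K /hN hK i j; apply: (hK (i, j)).
Qed.

Lemma cvg_mx_entry D (u : nat -> 'M[C]_D) (L : 'M[C]_D) i j :
  cvg_mx u L -> cvgs (fun K => u K i j) (L i j).
Proof. by move=> h e /h[N0 hN]; exists N0 => k /hN. Qed.

Lemma ces_avg_entry D (P : nat -> 'M[C]_D) K i j :
  ces_avg P K i j = avg (fun k => (maxabs (P k))^-1 * P k i j) K.
Proof. by rewrite !mxE summxE; congr (_ * _); apply: eq_bigr => k _; rewrite !mxE. Qed.

(** Changing finitely many normalisations does not alter a Cesaro limit, so [maxabs (P k)] may be
    replaced by its eventual value. *)
Lemma ces_avg_cvg D (P : nat -> 'M[C]_D) (L : 'M[C]_D) (a : nat -> C) N0 :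
  (forall k, (N0 <= k)%N -> maxabs (P k) = a k) ->
  (forall i j, cvgs (avg (fun k => (a k)^-1 * P k i j)) (L i j)) ->
  cvg_mx (ces_avg P) L.
Proof.
move=> h hL; apply: cvg_mxP => i j.
have h0 : cvgs (fun k => (maxabs (P k))^-1 * P k i j - (a k)^-1 * P k i j) 0.
  by apply: (@cvgs_eventually _ _ _ _ N0) (cvgs_cst 0) => k /h->; rewrite subrr.
rewrite -[L i j]addr0; apply: (cvgs_ext _ (cvgsD (hL i j) (cvgs_avg0 archC h0))) => K.
by rewrite ces_avg_entry -avgD; apply: avg_eq => k _; rewrite addrC subrK.
Qed.

Variables (D : nat) (J : 'M[C]_D).
Hypothesis jJ : jordan_form J.

Lemma jordan_nilpotent k : (forall i, J i i = 0) -> (D < k)%N -> J ^+ k = 0.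
Proof.
move=> h Dk; apply/matrixP => i j; rewrite jordan_pow // mxE h.
by rewrite /growth expr0n (_ : k - _ == 0 = false)%N ?mulr0 ?if_same //; have := ltn_ord j; lia.
Qed.

Lemma jordan_growth (i0 : 'I_D) : J i0 i0 != 0 -> exists r t,
  [/\ 0 < r,
     forall i j, chained J i j -> `|J i i| < r \/ `|J i i| = r /\ (j - i <= t)%N
   & exists N0, forall k, (N0 <= k)%N -> maxabs (J ^+ k) = growth r t k].
Proof.
move=> Ji0; have [rge0 rge rE] := bigmax_ge0_cases (fun i => normr_ge0 (J i i)).
set r := \big[_/_]_i _ in rge0 rge rE.
have r0 : 0 < r by apply: lt_le_trans (rge i0); rewrite normr_gt0.
have {rE}[i1 ri1] : exists i1, r = `|J i1 i1| by case: rE => // r00; rewrite r00 ltxx in r0.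
(* Among the chains with eigenvalue of modulus [r], a longest one runs from [i2] to [j2]; its length
   gives [t]. *)
pose P (p : 'I_D * 'I_D) := chained J p.1 p.2 && (`|J p.1 p.1| == r).
have P1 : P (i1, i1) by rewrite /P chained_refl -ri1 eqxx.
have [[i2 j2] /andP[/= c2 /eqP r2] max2] := arg_maxnP (fun p : 'I_D * 'I_D => p.2 - p.1)%N P1.
pose t := (j2 - i2)%N.
have dom i j : chained J i j -> `|J i i| < r \/ `|J i i| = r /\ (j - i <= t)%N.
  move=> cij; have := rge i; rewrite le_eqVlt => /orP[/eqP e|]; last by left.
  by right; split=> //; apply: (max2 (i, j)); rewrite /P cij e eqxx.
exists r, t; split=> //.
(* Entries with modulus [r] and distance [t] meet the bound with equality. The other non-zero ones
   are dominated, so their quotient by [growth r t k] is eventually below 1. *)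
have [|N0 hN] := @eventually_forall ('I_D * 'I_D)%type
    (fun p k => `|(J ^+ k) p.1 p.2| <= growth r t k).
  move=> [i j] /=; have [cij|ncij] := boolP (chained J i j); last first.
    by exists 0%N => k _; rewrite jordan_pow // (negPf ncij) normr0 growth_ge0.
  have [[e1 e2]|ne] := pselect (`|J i i| = r /\ (j - i)%N = t).
    by exists 0%N => k _; rewrite jordan_pow // cij norm_growth e1 e2.
  have [|N1 hN] := growth_dominated archC (x := J i i) (u := (j - i)%N) (t := t) r0 _ ltr01.
    case: (dom _ _ cij) => [|[e1]]; first by left.
    by rewrite leq_eqVlt => /orP[/eqP e2|]; [case: ne|right].
  exists (maxn N1 t) => k; rewrite geq_max => /andP[k1 kt].
  have := hN _ k1; rewrite subr0 normrM normfV (ger0_norm (growth_ge0 _ _ (ltW r0))).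
  rewrite ltr_pdivrMr ?growth_gt0 // mul1r => /ltW.
  by rewrite jordan_pow // cij.
exists N0 => k kN; apply: le_anti; apply/andP; split.
  by apply: maxabs_le => [|i j]; [exact: growth_ge0 (ltW r0)|exact: (hN _ kN (i, j))].
apply: le_trans (maxabs_ge _ i2 j2).
by rewrite jordan_pow // c2 norm_growth r2.
Qed.

Definition top_part (r : C) t : 'M[C]_D :=
  \matrix_(i, j) (chained J i j && (J i i == r) && ((j - i)%N == t))%:R.

(** The diagonal of [J] contributes the factor [r]. An off-diagonal contribution would lengthen a
    chain of length [t] to [t + 1] with the same eigenvalue [r]. *)
Lemma top_part_eigen r t :
  (forall i j, chained J i j -> J i i = r -> (j - i <= t)%N) ->
  J *m top_part r t = r *: top_part r t /\ top_part r t *m J = r *: top_part r t.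
Proof.
move=> ht; split; apply/matrixP => i j; rewrite ?(jordan_mull jJ) ?(jordan_mulr jJ) big1 ?addr0.
- rewrite !mxE; case: eqP => [->//|_]; rewrite andbF /= !mulr0 //.
- move=> p /eqP pi; rewrite !mxE.
  have [/andP[/andP[cpj /eqP pr] /eqP pt]|] := boolP (_ && _); last by rewrite mulr0.
  have [_ [//|->|e]] := jJ i p; first by rewrite mul0r.
  move=> /(_ pi e) ip.
  have pj : (p <= j)%N by case/chainedP: cpj.
  have cij : chained J i j by rewrite (chained_consl J pi pj) e eqxx.
  have := ht _ _ cij; rewrite ip pr => /(_ erefl); lia.
- rewrite !mxE; have [/andP[/andP[cij /eqP ir] _]|] := boolP (_ && _); last by rewrite mul0r mulr0.
  by rewrite mulr1 mul1r -(chained_diag jJ cij).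
- move=> p /eqP jp; rewrite !mxE.
  have [/andP[/andP[cip /eqP ir] /eqP pt]|] := boolP (_ && _); last by rewrite mul0r.
  have [_ [//|->|e]] := jJ p j; first by rewrite mulr0.
  move=> /(_ jp e) ip.
  have pj : (i <= p)%N by case/chainedP: cip.
  have cij : chained J i j by rewrite (chained_consr J jp pj) e eqxx andbT.
  have := ht _ _ cij ir; lia.
Qed.

(** Entries of smaller growth tend to 0. An entry of maximal growth becomes a geometric sequence
    with ratio [z = J i i / r] of modulus 1, whose mean tends to 0 unless [z = 1]. *)
Lemma top_part_cvg r t :
  0 < r ->
  (forall i j, chained J i j -> `|J i i| < r \/ `|J i i| = r /\ (j - i <= t)%N) ->
  forall i j, cvgs (avg (fun k => (growth r t k)^-1 * (J ^+ k) i j)) (top_part r t i j).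
Proof.
move=> r0 dom i j; rewrite mxE.
have [cij|ncij] := boolP (chained J i j); last first.
  apply: cvgs_avg => //; apply: (cvgs_ext _ (cvgs_cst 0)) => k.
  by rewrite jordan_pow // (negPf ncij) mulr0.
have [[e1 e2]|ne] := pselect (`|J i i| = r /\ (j - i)%N = t); last first.
  rewrite (_ : _ && _ = false); last first.
    apply/negP => /andP[/andP[_ /eqP e1] /eqP e2]; apply: ne.
    by rewrite e1 ger0_norm ?(ltW r0).
  apply: cvgs_avg => //; have : cvgs (fun k => growth (J i i) (j - i) k / growth r t k) 0.
    apply: growth_dominated => //; case: (dom _ _ cij) => [|[e1]]; first by left.
    by rewrite leq_eqVlt => /orP[/eqP e2|]; [case: ne|right].
  by apply: cvgs_ext => k; rewrite jordan_pow // cij mulrC.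
have J0 : J i i != 0 by rewrite -normr_gt0 e1.
pose z := J i i / r.
(* For [t <= k] the binomials cancel and [z ^+ (k - t)] remains; the finitely many earlier terms
   disappear in the average. *)
have zE k : (t <= k)%N -> (growth r t k)^-1 * (J ^+ k) i j = (z ^+ t)^-1 * z ^+ k.
  move=> tk; rewrite jordan_pow // cij e2 /growth /z.
  rewrite -[in RHS](subnK tk) exprD [RHS]mulrCA mulVf ?mulr1; last first.
    by rewrite expf_neq0 // mulf_neq0 // invr_eq0 gt_eqF.
  rewrite expr_div_n invfM mulrACA mulVf ?mul1r 1?mulrC //.
  by rewrite pnatr_eq0 -lt0n bin_gt0.
rewrite andTb e2 eqxx andbT.
pose w k := (growth r t k)^-1 * (J ^+ k) i j - (z ^+ t)^-1 * z ^+ k.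
have w0 : cvgs w 0.
  by apply: (@cvgs_eventually _ _ _ _ t) (cvgs_cst 0) => k /zE; rewrite /w => ->; rewrite subrr.
suff h : cvgs (avg (fun k => (z ^+ t)^-1 * z ^+ k)) (J i i == r)%:R.
  rewrite -[_%:R]addr0; apply: (cvgs_ext _ (cvgsD h (cvgs_avg0 archC w0))) => K.
  by rewrite -avgD; apply: avg_eq => k _; rewrite /w addrC subrK.
have [e|ne] := eqVneq (J i i) r.
  apply: cvgs_avg => //; apply: (cvgs_ext _ (cvgs_cst 1)) => k.
  by rewrite /z e divff ?gt_eqF // !expr1n mulr1 invr1.
rewrite -[0%:R](mulr0 (z ^+ t)^-1).
apply: (cvgs_ext (avgMl _ _)); apply: cvgsMl; apply: cvgs_avg_geometric => //.
  by rewrite normrM normfV e1 (gtr0_norm r0) divff // gt_eqF.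
apply: contra ne => /eqP z1; apply/eqP.
by rewrite -[r]mul1r -z1 divfK // gt_eqF.
Qed.

Theorem jordan_cesaro (i0 : 'I_D) : J i0 i0 != 0 -> exists r t (L : 'M[C]_D),
  [/\ 0 < r, exists N0, forall k, (N0 <= k)%N -> maxabs (J ^+ k) = growth r t k,
      forall i j, cvgs (avg (fun k => (growth r t k)^-1 * (J ^+ k) i j)) (L i j),
      J *m L = r *: L & L *m J = r *: L].
Proof.
move=> /jordan_growth[r [t [r0 dom mE]]].
have [|JL LJ] := @top_part_eigen r t.
  move=> i j cij ir; case: (dom _ _ cij) => [|[]//].
  by rewrite ir gtr0_norm // ltxx.
exists r, t, (top_part r t); split=> //.
exact: top_part_cvg.
Qed.
End JordanLimit.

(** * Comparison of growth rates and transfer of the limit to another Jordan matrix *)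

Section Transfer.
Variable C : numClosedFieldType.
Hypothesis archC : forall x : C, exists n : nat, `|x| < n%:R.

Lemma ler_sum_ge0 (T : finType) (F : T -> C) i : (forall i, 0 <= F i) -> F i <= \sum_i F i.
Proof. by move=> F0; rewrite (bigD1 i) //= lerDl sumr_ge0. Qed.

Lemma sandwich_entry D1 D2 (T : 'M[C]_(D1, D2)) (M : 'M[C]_D2) (T' : 'M[C]_(D2, D1)) i j :
  (T *m M *m T') i j = \sum_p \sum_q (T i p * T' q j) * M p q.
Proof.
rewrite mxE exchange_big; apply: eq_bigr => q _.
by rewrite mxE mulr_suml; apply: eq_bigr => p _; rewrite mulrAC.
Qed.

Lemma sandwich_le D1 D2 (T : 'M[C]_(D1, D2)) (T' : 'M[C]_(D2, D1)) :
  exists2 c, 0 < c & forall M : 'M[C]_D2, maxabs (T *m M *m T') <= c * maxabs M.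
Proof.
pose w i j := \sum_(p < D2) \sum_(q < D2) `|T i p * T' q j|.
have w0 i j : 0 <= w i j by do 2!apply: sumr_ge0 => ? _; apply: normr_ge0.
(* The constant is [1 + s] because [s] itself may be 0. *)
pose s := \sum_i \sum_j w i j.
have s0 : 0 <= s by do 2!apply: sumr_ge0 => ? _; apply: w0.
have ws i j : w i j <= 1 + s.
  apply: ler_wpDl => //; apply: le_trans (ler_sum_ge0 i _) => [|i'].
    exact: ler_sum_ge0.
  exact: sumr_ge0.
exists (1 + s); first by rewrite ltr_pwDl.
move=> M; apply: maxabs_le => [|i j].
  by rewrite mulr_ge0 ?maxabs_ge0 // addr_ge0.
apply: le_trans (ler_wpM2r (maxabs_ge0 M) (ws i j)); rewrite sandwich_entry /w mulr_suml.
apply: le_trans (ler_norm_sum _ _ _) _; apply: ler_sum => p _.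
rewrite mulr_suml; apply: le_trans (ler_norm_sum _ _ _) _; apply: ler_sum => q _.
by rewrite normrM ler_wpM2l // maxabs_ge.
Qed.

(** If [(r2, t2)] were lexicographically smaller, the quotient of the two growths would tend to 0,
    while the hypothesis keeps [c] times it at least 1. *)
Lemma growth_le_lex (r1 r2 : C) t1 t2 c N0 : 0 < r1 -> 0 < r2 ->
  (forall k, (N0 <= k)%N -> growth r1 t1 k <= c * growth r2 t2 k) ->
  ~ (r2 < r1 \/ r2 = r1 /\ (t2 < t1)%N).
Proof.
move=> r10 r20 h lex.
have dom : cvgs (fun k => growth r2 t2 k / growth r1 t1 k) 0.
  by apply: growth_dominated => //; rewrite gtr0_norm.
have := cvgsMl c dom; rewrite mulr0 => /(_ 1 ltr01)[N1 h1].
pose k := (maxn N0 N1 + t1)%N.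
have := h1 k; rewrite /k; set k' := (_ + _)%N => /(_ _); rewrite subr0.
have kN0 : (N0 <= k')%N by rewrite /k'; lia.
have kN1 : (N1 <= k')%N by rewrite /k'; lia.
have kt : (t1 <= k')%N by rewrite /k'; lia.
have g1 := growth_gt0 r10 kt.
have le1 : 1 <= c * (growth r2 t2 k' / growth r1 t1 k').
  by rewrite mulrA ler_pdivlMr // mul1r h.
move=> /(_ kN1); rewrite ger0_norm ?(le_trans _ le1) // => lt1.
by have := le_lt_trans le1 lt1; rewrite ltxx.
Qed.

Lemma growth_inj (r1 r2 : C) t1 t2 c d N0 : 0 < r1 -> 0 < r2 ->
  (forall k, (N0 <= k)%N -> growth r1 t1 k <= c * growth r2 t2 k) ->
  (forall k, (N0 <= k)%N -> growth r2 t2 k <= d * growth r1 t1 k) ->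
  r1 = r2 /\ t1 = t2.
Proof.
move=> r10 r20 /(growth_le_lex r10 r20) h1 /(growth_le_lex r20 r10) h2.
have r12 : r1 = r2.
  by have [lt|lt|//] := real_ltgtP (gtr0_real r10) (gtr0_real r20); [case: h2|case: h1]; left.
by split=> //; have [lt|lt|//] := ltngtP t1 t2; [case: h2|case: h1]; right.
Qed.

(** The two sandwich identities bound the powers of each matrix by those of the other, so both have
    the same [(r, t)] and hence eventually the same normalisation; the averages then correspond
    linearly. *)
Lemma jordan_cesaro_transfer D1 D2 (J1 : 'M[C]_D1) (J2 : 'M[C]_D2)
    (T : 'M[C]_(D1, D2)) (T' : 'M[C]_(D2, D1)) r t (L : 'M[C]_D1) N0 :
  jordan_form J2 -> 0 < r ->
  (forall k, (N0 <= k)%N -> maxabs (J1 ^+ k) = growth r t k) ->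
  (forall i j, cvgs (avg (fun k => (growth r t k)^-1 * (J1 ^+ k) i j)) (L i j)) ->
  (forall k, (0 < k)%N -> J1 ^+ k = T *m J2 ^+ k *m T') ->
  (forall k, (0 < k)%N -> J2 ^+ k = T' *m J1 ^+ k *m T) ->
  cvg_mx (ces_avg (fun k => J2 ^+ k)) (T' *m L *m T).
Proof.
move=> jJ2 r0 m1 hL J12 J21.
(* A nilpotent [J2] would make [J1 ^+ k] vanish for large [k], against the positivity of
   [growth r t k]. *)
have [i0 Ji0] : exists i0, J2 i0 i0 != 0.
  apply: contrapT => /forallNP h.
  have J20 k : (D2 < k)%N -> J2 ^+ k = 0.
    by apply: jordan_nilpotent => // i; apply: contrapT => /eqP; apply: h.
  pose k := (maxn N0 (maxn D2.+1 t))%N.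
  have := m1 k; rewrite J12 ?J20 ?mulmx0 ?mul0mx; try by rewrite /k; lia.
  have -> : maxabs (0 : 'M[C]_D1) = 0.
    by apply: le_anti; rewrite maxabs_ge0 maxabs_le // => i j; rewrite mxE normr0.
  have gt : 0 < growth r t k by apply: growth_gt0 => //; rewrite /k; lia.
  by move=> /(_ (leq_maxl _ _)) e; rewrite -e ltxx in gt.
have [r2 [t2 [r20 _ [N2 m2]]]] := jordan_growth archC jJ2 Ji0.
have [c c0 hc] := sandwich_le T T'.
have [d d0 hd] := sandwich_le T' T.
have [] := @growth_inj r r2 t t2 c d (maxn 1 (maxn N0 N2)) r0 r20.
- by move=> k kN; rewrite -m1 -?m2 ?J12; try lia; apply: hc.
- by move=> k kN; rewrite -m1 -?m2 ?J21; try lia; apply: hd.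
move=> er et; subst r2 t2; apply: (ces_avg_cvg archC m2) => i j.
rewrite sandwich_entry.
have h : cvgs (fun K => \sum_p \sum_q T' i p * T q j * avg (fun k => (growth r t k)^-1 * (J1 ^+ k) p q) K)
  (\sum_p \sum_q T' i p * T q j * L p q).
  by do 2!apply: cvgs_sum => ?; apply: cvgsMl.
apply: cvgs_ext h => K.
under [RHS]eq_bigr do under eq_bigr do rewrite -avgMl.
under [RHS]eq_bigr do rewrite -avg_sum.
rewrite -avg_sum; apply: avg_eq => k k0; rewrite J21 // sandwich_entry mulr_sumr.
by apply: eq_bigr => p _; rewrite mulr_sumr; apply: eq_bigr => q _; rewrite mulrCA.
Qed.
End Transfer.

(** * Bases and maximal parts *)

Section Bases.
Variables (C : numClosedFieldType) (N : nat).
Local Notation Mat := 'M[C]_N.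
Implicit Types (S : Mat -> Prop) (f g : Mat -> Mat).

Definition subspace S := S 0 /\ forall a X Y, S X -> S Y -> S (a *: X + Y).

Lemma subspaceT : subspace (fun=> True). Proof. by []. Qed.

Lemma subspace_sum S (T : finType) (c : T -> C) (F : T -> Mat) :
  subspace S -> (forall i, S (F i)) -> S (\sum_i c i *: F i).
Proof.
move=> [S0 SD] SF; elim: (index_enum T) => [|i s IH]; rewrite ?big_nil ?big_cons //.
exact: SD.
Qed.

Lemma lin_on_sum S f (T : finType) (c : T -> C) (F : T -> Mat) :
  subspace S -> lin_on S f -> (forall i, S (F i)) ->
  f (\sum_i c i *: F i) = \sum_i c i *: f (F i).
Proof.
move=> [S0 SD] lf SF.
have f0 : f 0 = 0.
  have := lf 1 0 0 S0 S0; rewrite !scale1r addr0 => /eqP.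
  by rewrite -subr_eq0 opprD addNKr oppr_eq0 => /eqP.
suff [] : S (\sum_(i <- index_enum T) c i *: F i) /\
  f (\sum_(i <- index_enum T) c i *: F i) = \sum_(i <- index_enum T) c i *: f (F i) by [].
elim: (index_enum T) => [|i s [IH1 IH2]]; rewrite ?big_nil ?big_cons //.
by split; [exact: SD|rewrite lf // IH2].
Qed.

(** A vector space of maximal dimension inside [S] is all of [S], since an element outside it would
    enlarge it. *)
Lemma subspace_basis S : subspace S -> exists D (b : 'I_D -> Mat), is_basis S b.
Proof.
move=> SS; have [S0 SD] := SS.
pose P k := `[< exists2 U : {vspace Mat}, \dim U = k & forall X, X \in U -> S X >].
have exP : exists k, P k.
  exists 0%N; apply/asboolP; exists 0%VS; first exact: dimv0.
  by move=> X; rewrite memv0 => /eqP->.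
have bP k : P k -> (k <= \dim {:Mat})%N.
  by move=> /asboolP[U <- _]; apply: dimvS; apply: subvf.
case: (ex_maxnP exP bP) => D /asboolP[U dU SU] maxD.
have SE X : S X -> X \in U.
  move=> SX; apply: contrapT => /negP XU.
  have /maxD : P (\dim (U + <[X]>)).
    apply/asboolP; exists (U + <[X]>)%VS => // Y /memv_addP[Z ZU [_ /vlineP[a ->] ->]].
    by rewrite addrC; apply: SD => //; apply: SU.
  rewrite leqNgt -dU => /negP; apply; rewrite ltn_neqAle dimvS ?addvSl // andbT.
  apply: contra XU => /eqP dE.
  have /eqP -> : U == (U + <[X]>)%VS by rewrite eqEdim addvSl dE leqnn.
  by apply: subvP (addvSr U <[X]>%VS) _ (memv_line X).
have [b0 b0U] : exists b0 : (\dim U).-tuple Mat, basis_of U b0.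
  by exists (vbasis U); apply: vbasisP.
exists (\dim U), (fun i => b0`_i); split.
- by move=> i; apply: SU; apply: (basis_mem b0U); apply: mem_nth; rewrite size_tuple.
- by move=> c h; move/freeP: (basis_free b0U) => /(_ c h).
by move=> X /SE XU; exists (fun i => coord b0 i X); apply: (coord_basis b0U).
Qed.

(** Bilinear, without conjugation, so that it represents the linear functionals on matrices. *)
Definition pairing (w X : Mat) : C := \sum_a \sum_b w a b * X a b.

Lemma pairing_mxvec D (M : 'M[C]_(N * N, D)) i X :
  pairing (\matrix_(a, c) M (mxvec_index a c) i) X = (mxvec X *m M) 0 i.
Proof.
rewrite mxE (reindex _ (curry_mxvec_bij _ _)) /pairing pair_bigA /=.
by apply: eq_bigr => -[a c] _; rewrite mxE mxvecE mulrC.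
Qed.

Lemma pairing_sum w (T : finType) (c : T -> C) (F : T -> Mat) :
  pairing w (\sum_i c i *: F i) = \sum_i c i * pairing w (F i).
Proof.
rewrite /pairing; under eq_bigr do under eq_bigr do rewrite summxE mulr_sumr.
under eq_bigr do rewrite exchange_big.
rewrite exchange_big; apply: eq_bigr => i _; rewrite mulr_sumr; apply: eq_bigr => a _.
by rewrite mulr_sumr; apply: eq_bigr => e _; rewrite mxE mulrCA.
Qed.

(** The basis written as rows is row free; the columns of a right inverse are coordinate
    functionals, defined on all matrices. *)
Lemma basis_dual S D (b : 'I_D -> Mat) : is_basis S b ->
  exists w : 'I_D -> Mat, forall X, S X -> X = \sum_i pairing (w i) X *: b i.
Proof.
move=> [_ indep span].
pose B := \matrix_(i < D) mxvec (b i).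
have /row_freeP[B' BB'] : row_free B.
  apply: inj_row_free => v vB; apply/rowP => i; rewrite mxE.
  apply: (indep (fun i => v 0 i)).
  apply: (can_inj mxvecK); rewrite /lincomb linear_sum [RHS]linear0 -[RHS]vB mulmx_sum_row.
  by apply: eq_bigr => j _; rewrite linearZ /= rowK.
exists (fun i => \matrix_(a, c) B' (mxvec_index a c) i) => X SX.
have [c XE] := span X SX.
have -> : X = vec_mx ((\row_i c i) *m B).
  rewrite mulmx_sum_row linear_sum XE; apply: eq_bigr => i _.
  by rewrite linearZ /= rowK mxvecK mxE.
rewrite {1}mulmx_sum_row linear_sum; apply: eq_bigr => i _.
by rewrite linearZ /= rowK mxvecK pairing_mxvec vec_mxK -mulmxA BB' mulmx1.
Qed.

(** A subspace equals its double annihilator: the columns of a cokernel matrix of a basis serve as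
    test functionals. *)
Lemma subspace_annihilator S X : subspace S ->
  (forall z, (forall Y, S Y -> pairing z Y = 0) -> pairing z X = 0) -> S X.
Proof.
move=> SS h; have [D [b [Sb _ span]]] := subspace_basis SS.
pose W := \matrix_(j < D) mxvec (b j).
have /submxP[E XE] : (mxvec X <= W)%MS.
  rewrite submxE; apply/eqP/rowP => k; rewrite [RHS]mxE -pairing_mxvec.
  apply: h => Y /span[c ->]; rewrite pairing_sum big1 // => j _.
  rewrite pairing_mxvec -[mxvec (b j)](rowK (fun j => mxvec (b j))) -row_mul.
  by rewrite mulmx_coker row0 mxE mulr0.
rewrite -[X]mxvecK XE mulmx_sum_row linear_sum.
under eq_bigr do rewrite linearZ /= rowK mxvecK.
exact: subspace_sum.
Qed.

Definition mcomb D E (b : 'I_D -> Mat) (M : 'M[C]_(D, E)) (j : 'I_E) : Mat :=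
  \sum_i M i j *: b i.

Lemma mcombM D D' E (b : 'I_D -> Mat) (b' : 'I_D' -> Mat) (M : 'M[C]_(D', D)) (X : 'M[C]_(D, E)) j :
  (forall i, b i = mcomb b' M i) -> mcomb b X j = mcomb b' (M *m X) j.
Proof.
move=> bE; rewrite /mcomb.
under eq_bigr do rewrite bE /mcomb scaler_sumr.
rewrite exchange_big; apply: eq_bigr => l _.
rewrite mxE scaler_suml; apply: eq_bigr => i _.
by rewrite scalerA mulrC.
Qed.

Lemma lin_on_mcomb S f D D' E (b : 'I_D -> Mat) (b' : 'I_D' -> Mat) (M : 'M[C]_(D', D)) (X : 'M[C]_(D, E)) j :
  subspace S -> lin_on S f -> (forall i, S (b i)) ->
  (forall i, f (b i) = mcomb b' M i) -> f (mcomb b X j) = mcomb b' (M *m X) j.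
Proof.
move=> SS lf Sb bE; rewrite -(@mcombM _ _ _ (f \o b)) //.
exact: (lin_on_sum _ SS lf Sb).
Qed.

Lemma mcomb_inj S D E (b : 'I_D -> Mat) (M M' : 'M[C]_(D, E)) :
  is_basis S b -> (forall j, mcomb b M j = mcomb b M' j) -> M = M'.
Proof.
move=> [_ indep _] h; apply/matrixP => i j; apply/eqP; rewrite -subr_eq0; apply/eqP.
apply: (indep (fun i => M i j - M' i j)).
rewrite /lincomb; under eq_bigr do rewrite scalerBl.
by rewrite sumrB; apply/eqP; rewrite subr_eq0; apply/eqP; apply: h.
Qed.

Lemma basis_mcomb S D E (b : 'I_D -> Mat) (F : 'I_E -> Mat) :
  is_basis S b -> (forall j, S (F j)) -> exists M : 'M[C]_(D, E), forall j, F j = mcomb b M j.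
Proof.
move=> [_ _ span] SF; have /fin_all_exists[c cE] := fun j => span (F j) (SF j).
exists (\matrix_(i, j) c j i) => j; rewrite (cE j).
by apply: eq_bigr => i _; rewrite mxE.
Qed.

Lemma mcomb_mem S D E (b : 'I_D -> Mat) (M : 'M[C]_(D, E)) j :
  subspace S -> is_basis S b -> S (mcomb b M j).
Proof. by move=> SS [Sb _ _]; apply: subspace_sum. Qed.

Lemma iter_stable S f k X : (forall X, S X -> S (f X)) -> S X -> S (iter k f X).
Proof. by move=> Sf SX; elim: k => //= k; apply: Sf. Qed.

Lemma iter_mcomb S f D E (b : 'I_D -> Mat) (M : 'M[C]_D) (X : 'M[C]_(D, E)) k j :
  subspace S -> lin_on S f -> is_basis S b -> mx_in_basis b f M ->
  iter k f (mcomb b X j) = mcomb b (M ^+ k *m X) j.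
Proof.
move=> SS lf bS fM; elim: k => [|k IH]; first by rewrite expr0 mul1mx.
by rewrite iterS IH (lin_on_mcomb _ _ SS lf (b' := b) (M := M)) ?mulmxA ?exprS //; case: bS.
Qed.

Lemma mcomb1 D (b : 'I_D -> Mat) j : mcomb b 1%:M j = b j.
Proof.
rewrite /mcomb (bigD1 j) //= mxE eqxx scale1r big1 ?addr0 // => i ij.
by rewrite mxE (negPf ij) scale0r.
Qed.

Lemma mx_in_basis_pow S f D (b : 'I_D -> Mat) (M P : 'M[C]_D) k :
  subspace S -> lin_on S f -> is_basis S b -> mx_in_basis b f M ->
  mx_in_basis b (iter k f) P -> P = M ^+ k.
Proof.
move=> SS lf bS fM fP; apply: (mcomb_inj bS) => j.
by rewrite -[M ^+ k]mulmx1 -(iter_mcomb _ _ _ SS lf bS fM) mcomb1 fP.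
Qed.

Lemma jordan_basis_exists S f : subspace S -> lin_on S f ->
  (forall X, S X -> S (f X)) -> exists D (b : 'I_D -> Mat) J, jordan_basis S f b J.
Proof.
move=> SS lf Sf; have [D [b bS]] := subspace_basis SS.
have Sb : forall i, S (b i) by case: bS.
have [M fM] := basis_mcomb bS (fun j => Sf _ (Sb j)).
have [P [J [uP MP jJ]]] := jordan_exists M.
exists D, (mcomb b P), J; split=> //; last first.
  by move=> j; rewrite (lin_on_mcomb _ _ SS lf Sb fM) MP -(@mcombM _ _ _ (mcomb b P)).
split=> [i|c c0 i|X SX]; first exact: mcomb_mem.
  pose x := \col_i c i.
  have : mcomb b (P *m x) = mcomb b (P *m 0).
    apply/funext => j; rewrite -(@mcombM _ _ _ (mcomb b P)) // mulmx0.
    rewrite [RHS]big1 => [|k _]; last by rewrite mxE scale0r.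
    by rewrite -[RHS]c0; apply: eq_bigr => k _; rewrite mxE.
  move=> h; have /(can_inj (mulKmx uP)) : P *m x = P *m 0.
    by apply: (mcomb_inj bS) => j; rewrite h.
  by move/matrixP/(_ i 0); rewrite !mxE.
have [_ _ /(_ X SX)[c XE]] := bS.
exists (fun i => (invmx P *m \col_i c i) i 0).
have := @mcombM _ _ _ (mcomb b P) b P (invmx P *m \col_i c i) 0 (fun i => erefl).
rewrite mulKVmx // /lincomb {1}/mcomb => ->; rewrite XE.
by apply: eq_bigr => i _; rewrite mxE.
Qed.

(** After one step all iterates lie in [S], where [phi] is the identity. For [k = 0] the sides would
    be [X] and [phi X]. *)
Lemma iter_comp_proj S S2 f phi k X :
  (forall X, S X -> S (f X)) -> (forall X, S2 X -> S (phi X)) -> (forall X, S X -> phi X = X) ->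
  S2 X -> (0 < k)%N -> iter k (f \o phi) X = iter k f (phi X).
Proof.
move=> Sf Sphi phiid SX; case: k => // k _; elim: k => //= k ->.
by rewrite phiid //; apply: (@iter_stable S f k.+1) => //; apply: Sphi.
Qed.

Hypothesis archC : forall x : C, exists n : nat, `|x| < n%:R.

(** Transports the limit known in one Jordan basis of [f] to every Jordan basis of [f \o phi], for a
    projection [phi] of [S2] onto [S]. It serves for the canonical extension and, with [phi] the
    identity, for [tau] itself. *)
Lemma maxpart_proj S S2 f g phi D (b : 'I_D -> Mat) J r t (L : 'M[C]_D) N0 :
  subspace S -> subspace S2 -> (forall X, S X -> S2 X) ->
  lin_on S2 phi -> (forall X, S2 X -> S (phi X)) -> (forall X, S X -> phi X = X) ->
  lin_on S f -> (forall X, S X -> S (f X)) -> lin_on S g -> mx_in_basis b g L ->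
  jordan_basis S f b J -> 0 < r ->
  (forall k, (N0 <= k)%N -> maxabs (J ^+ k) = growth r t k) ->
  (forall i j, cvgs (avg (fun k => (growth r t k)^-1 * (J ^+ k) i j)) (L i j)) ->
  maxpart S2 (f \o phi) (g \o phi).
Proof.
move=> SS SS2 S12 lphi Sphi phiid lf Sf lg gL [bS fJ jJ] r0 m1 hL.
have lfphi : lin_on S2 (f \o phi).
  by move=> a X Y SX SY; rewrite /= lphi // lf //; apply: Sphi.
split; first by move=> a X Y SX SY; rewrite /= lphi // lg //; apply: Sphi.
  by apply: jordan_basis_exists => // X SX; apply: S12; apply: Sf; apply: Sphi.
move=> D2 b2 J2 [b2S fJ2 jJ2] P hP.
have PE : P = fun k => J2 ^+ k.
  by apply/funext => k; apply: (mx_in_basis_pow SS2 lfphi b2S fJ2).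
have Sb : forall i, S (b i) by case: bS.
have Sb2 : forall i, S2 (b2 i) by case: b2S.
(* [T] is the matrix of the projection [phi] and [T'] that of the inclusion of [S] in [S2]. *)
have [T TE] := basis_mcomb bS (fun j => Sphi _ (Sb2 j)).
have [T' T'E] := basis_mcomb b2S (fun j => S12 _ (Sb j)).
have iterE k X : S2 X -> (0 < k)%N -> iter k (f \o phi) X = iter k f (phi X).
  exact: (iter_comp_proj Sf Sphi phiid).
have J21 k : (0 < k)%N -> J2 ^+ k = T' *m J ^+ k *m T.
  move=> k0; apply: (mcomb_inj b2S) => j.
  rewrite -[J2 ^+ k]mulmx1 -(iter_mcomb _ _ _ SS2 lfphi b2S fJ2) mcomb1 iterE //.
  by rewrite TE (iter_mcomb _ _ _ SS lf bS fJ) (mcombM _ _ T'E) mulmxA.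
have J12 k : (0 < k)%N -> J ^+ k = T *m J2 ^+ k *m T'.
  move=> k0; apply: (mcomb_inj bS) => j.
  rewrite -[J ^+ k]mulmx1 -(iter_mcomb _ _ _ SS lf bS fJ) mcomb1.
  have -> : iter k f (b j) = phi (iter k (f \o phi) (b j)).
    rewrite iterE //; last exact: S12.
    by rewrite [in RHS]phiid // phiid //; apply: iter_stable.
  rewrite T'E (iter_mcomb _ _ _ SS2 lfphi b2S fJ2).
  by rewrite (lin_on_mcomb _ _ SS2 lphi Sb2 TE) mulmxA.
exists (T' *m L *m T).
  move=> j; rewrite /= TE (lin_on_mcomb _ _ SS lg Sb gL).
  by rewrite (mcombM _ _ T'E) mulmxA.
rewrite PE; apply: (jordan_cesaro_transfer archC jJ2 r0 m1 hL) => //.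
Qed.
End Bases.

(** * Kraus operators of the maximal part *)

Section Kraus.
Variables (C : numClosedFieldType) (N : nat).
Local Notation Mat := 'M[C]_N.
Implicit Types (S : Mat -> Prop) (f g : Mat -> Mat).

(** Any finite index type is allowed, so that compositions can be indexed by pairs. *)
Definition fkraus (T : finType) f (K : T -> Mat) : Prop :=
  forall X, f X = \sum_i (adjm (K i) *m X *m K i).

Lemma adjmM (X Y : Mat) : adjm (X *m Y) = adjm Y *m adjm X.
Proof. by rewrite /adjm trmx_mul map_mxM. Qed.

Lemma fkraus_comp (T T' : finType) f g (K : T -> Mat) (K' : T' -> Mat) :
  fkraus f K -> fkraus g K' -> fkraus (f \o g) (fun p : T * T' => K' p.2 *m K p.1).
Proof.
move=> fK gK X; rewrite /= fK gK -(pair_bigA _ (fun i j => adjm (K' j *m K i) *m X *m (K' j *m K i))) /=.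
apply: eq_bigr => i _; rewrite mulmx_sumr mulmx_suml; apply: eq_bigr => j _.
by rewrite adjmM !mulmxA.
Qed.

(** Kraus operators of an iterate are products of those of [f]. The case [k = 0] would need the
    identity matrix, which a non-unital algebra may lack. *)
Lemma fkraus_iter S f (T : finType) (K : T -> Mat) k :
  (forall X Y, S X -> S Y -> S (X *m Y)) -> (forall i, S (K i)) -> fkraus f K -> (0 < k)%N ->
  exists (T' : finType) (K' : T' -> Mat), fkraus (iter k f) K' /\ forall i, S (K' i).
Proof.
move=> SM SK fK; case: k => // k _; elim: k => [|k [T' [K' [fK' SK']]]].
  by exists T, K.
exists (T * T')%type, (fun p => K' p.2 *m K p.1); split; last by move=> p; apply: SM.
exact: (fkraus_comp fK fK').
Qed.

Lemma fkraus_entry (T : finType) f (K : T -> Mat) a b c d : fkraus f K ->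
  f (delta_mx a b) c d = \sum_i (K i a c)^* * K i b d.
Proof.
move=> fK; rewrite fK summxE; apply: eq_bigr => i _.
rewrite -(mul_delta_mx (0 : 'I_1)) mulmxA -colE -mulmxA -rowE mxE big_ord1.
by rewrite !mxE.
Qed.

(** The quadratic form of the Choi matrix of [f]; it depends on [f] alone and not on a choice of
    Kraus operators. *)
Definition choi_form f (z : Mat) : C :=
  \sum_a \sum_c \sum_b \sum_d ((z a c)^* * z b d) * f (delta_mx a b) c d.

Lemma choi_form_kraus (T : finType) f (K : T -> Mat) z : fkraus f K ->
  choi_form f z = \sum_i `|pairing z (K i)| ^+ 2.
Proof.
move=> fK; rewrite /choi_form.
under eq_bigr do under eq_bigr do under eq_bigr do under eq_bigr do
  rewrite (fkraus_entry _ _ _ _ fK) mulr_sumr.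
under eq_bigr do under eq_bigr do under eq_bigr do rewrite exchange_big.
under eq_bigr do under eq_bigr do rewrite exchange_big.
under eq_bigr do rewrite exchange_big.
rewrite exchange_big; apply: eq_bigr => i _.
rewrite normCK mulrC /pairing rmorph_sum mulr_suml; apply: eq_bigr => a _.
rewrite rmorph_sum mulr_suml; apply: eq_bigr => c _.
rewrite mulr_sumr; apply: eq_bigr => b _; rewrite mulr_sumr; apply: eq_bigr => d _.
by rewrite rmorphM mulrACA.
Qed.

Lemma choi_form_eq0 (T : finType) f (K : T -> Mat) z : fkraus f K ->
  choi_form f z = 0 -> forall i, pairing z (K i) = 0.
Proof.
move=> fK; rewrite (choi_form_kraus z fK) => /eqP.
rewrite psumr_eq0 => [|i _]; last exact: exprn_ge0.
move=> /allP h i; have := h i (mem_index_enum i).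
by rewrite implyTb sqrf_eq0 normr_eq0 => /eqP.
Qed.

(** The trace of the Choi matrix of [f]. *)
Definition diag_trace f : C := \sum_a \sum_c f (delta_mx a a) c c.

(** Each entry is a sum of products of two Kraus entries, and such a product is at most the square
    of the larger modulus, which is a summand of the trace. *)
Lemma ler_norm_fkraus (T : finType) f (K : T -> Mat) a b c d : fkraus f K ->
  `|f (delta_mx a b) c d| <= diag_trace f.
Proof.
move=> fK; rewrite (fkraus_entry _ _ _ _ fK).
have -> : diag_trace f = \sum_i \sum_a \sum_c `|K i a c| ^+ 2.
  rewrite /diag_trace; under eq_bigr do under eq_bigr do rewrite (fkraus_entry _ _ _ _ fK).
  under eq_bigr do rewrite exchange_big.
  rewrite exchange_big; do 3!apply: eq_bigr => ? _.
  by rewrite normCK mulrC.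
apply: le_trans (ler_norm_sum _ _ _) _; apply: ler_sum => i _.
rewrite normrM norm_conjC.
have h a' c' : `|K i a' c'| ^+ 2 <= \sum_a \sum_c `|K i a c| ^+ 2.
  apply: le_trans (ler_sum_ge0 a' _) => [|a'']; last by apply: sumr_ge0 => *; apply: exprn_ge0.
  by apply: (@ler_sum_ge0 _ _ (fun c => `|K i a' c| ^+ 2)) => *; apply: exprn_ge0.
have [le|/ltW le] := real_leP (normr_real (K i a c)) (normr_real (K i b d)).
  by apply: le_trans (h b d); rewrite expr2 ler_wpM2r.
by apply: le_trans (h a c); rewrite expr2 ler_wpM2l.
Qed.

Lemma span_subspace q (B : 'I_q -> Mat) : subspace (span_of B).
Proof.
split; first by exists (fun=> 0); rewrite /lincomb big1 // => i _; rewrite scale0r.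
move=> a _ _ [c ->] [c' ->]; exists (fun i => a * c i + c' i).
rewrite /lincomb scaler_sumr -big_split; apply: eq_bigr => i _.
by rewrite scalerDl scalerA.
Qed.

Lemma span_mem q (B : 'I_q -> Mat) j : span_of B (B j).
Proof.
exists (fun i => (i == j)%:R); rewrite /lincomb (bigD1 j) //= eqxx scale1r big1 ?addr0 //.
by move=> i /negPf ->; rewrite scale0r.
Qed.

Lemma span_sub S q (B : 'I_q -> Mat) X :
  subspace S -> (forall j, S (B j)) -> span_of B X -> S X.
Proof. by move=> SS SB [c ->]; apply: subspace_sum. Qed.

(** A functional vanishing on all [B j] is a zero of the Choi form of [g], hence of [f = l g], hence
    it kills every [K i]. *)
Lemma fkraus_span (T : finType) f g (K : T -> Mat) q (B : 'I_q -> Mat) (l : C) i :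
  fkraus g B -> fkraus f K -> (forall X, f X = l *: g X) -> span_of B (K i).
Proof.
move=> gB fK fg; apply: subspace_annihilator; first exact: span_subspace.
move=> z zB; apply: (choi_form_eq0 fK).
have g0 : choi_form g z = 0.
  rewrite (choi_form_kraus _ gB) big1 // => j _.
  by rewrite zB ?normr0 ?expr0n //; apply: span_mem.
rewrite -[RHS](mulr0 l) -g0 /choi_form; do 4!(rewrite mulr_sumr; apply: eq_bigr => ? _).
by rewrite fg mxE mulrCA.
Qed.

Lemma gen_alg_subalg p (A : 'I_p -> Mat) : is_subalg (gen_alg A).
Proof.
split; first by move=> S [].
  by move=> a X Y hX hY S SS SA; case: (SS) => _ h _; apply: h; [apply: hX|apply: hY].
by move=> X Y hX hY S SS SA; case: (SS) => _ _ h; apply: h; [apply: hX|apply: hY].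
Qed.

Lemma gen_alg_mem p (A : 'I_p -> Mat) i : gen_alg A (A i).
Proof. by move=> S _; apply. Qed.

Section MaxPart.
Variables (F G : Mat -> Mat) (r l : C) (X0 : Mat) (p q : nat) (A : 'I_p -> Mat) (B : 'I_q -> Mat).
Hypotheses (linF : lin_on (fun=> True) F) (maxG : maxpart (fun=> True) F G).
Hypotheses (FG : forall X, F (G X) = r *: G X) (GF : forall X, G (F X) = r *: G X).
Hypotheses (X00 : X0 != 0) (l0 : l != 0) (FX0 : F X0 = l *: X0).
Hypotheses (FA : kraus F A) (GB : kraus G B).

(** A form of [maxpart] free of bases: the weights [m k] are the inverse norms, and the second
    property keeps the weighted traces away from 0. *)
Lemma maxpart_weights : exists2 m : nat -> C,
  forall X c d, cvgs (avg (fun k => m k * (iter k F X) c d)) (G X c d) &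
  exists2 s, 0 <= s & forall k, (0 < k)%N -> 0 <= m k /\ 1 <= s * (m k * diag_trace (iter k F)).
Proof.
have [linG [D [b [J [bS FJ jJ]]]] maxL] := maxG.
have SS := subspaceT C N.
have JP k : mx_in_basis b (iter k F) (J ^+ k).
  by move=> j; rewrite -[b j]mcomb1 (iter_mcomb _ _ _ SS linF bS FJ) mulmx1.
have [L GL cL] := maxL D b J (And3 bS FJ jJ) _ JP.
have [_ indep span] := bS.
(* The powers do not vanish because [F^k X0 = l^k X0] is non-zero. *)
have Jn0 k : 0 < maxabs (J ^+ k).
  rewrite lt_def maxabs_ge0 andbT; apply/eqP => J0.
  have Jk0 : J ^+ k = 0.
    apply/matrixP => i j; apply/eqP; rewrite mxE -normr_eq0; apply/eqP/le_anti.
    by rewrite normr_ge0 andbT -J0 maxabs_ge.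
  have [x xE] := basis_mcomb bS (fun _ : 'I_1 => I : (fun=> True) X0).
  have : iter k F X0 = 0.
    rewrite (xE 0) (iter_mcomb _ _ _ SS linF bS FJ) Jk0 mul0mx /mcomb big1 // => i _.
    by rewrite mxE scale0r.
  have -> : iter k F X0 = l ^+ k *: X0.
    elim: k {J0 Jk0} => [|k IH]; first by rewrite expr0 scale1r.
    have F0 : F 0 = 0 by have := lin_on_sum (fun=> 0) (F := fun _ : 'I_0 => X0) SS linF (fun _ => I); rewrite !big_ord0.
    rewrite iterS IH -[_ *: X0]addr0 linF // F0 addr0 FX0 scalerA exprSr //.
  by move/eqP; rewrite scaler_eq0 expf_eq0 (negPf l0) andbF (negPf X00).
exists (fun k => (maxabs (J ^+ k))^-1) => [X c d|].
  have [x xE] := basis_mcomb bS (fun _ : 'I_1 => I : (fun=> True) X).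
  rewrite (xE 0) (lin_on_mcomb _ _ SS linG (fun i => I) GL).
  have entry M : mcomb b (M *m x) 0 c d = \sum_i \sum_j (x j 0 * b i c d) * M i j.
    rewrite /mcomb summxE; apply: eq_bigr => i _; rewrite !mxE mulr_suml.
    by apply: eq_bigr => j _; rewrite mulrAC mulrC mulrA mulrAC mulrC.
  rewrite entry.
  have h : cvgs (fun K => \sum_i \sum_j (x j 0 * b i c d) * ces_avg (fun k => J ^+ k) K i j)
    (\sum_i \sum_j (x j 0 * b i c d) * L i j).
    by do 2!apply: cvgs_sum => ?; apply: cvgsMl; apply: cvg_mx_entry.
  apply: (cvgs_ext _ h) => K.
  under [RHS]eq_bigr do under eq_bigr do rewrite ces_avg_entry -avgMl.
  under [RHS]eq_bigr do rewrite -avg_sum.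
  rewrite -avg_sum; apply: avg_eq => k _.
  rewrite (iter_mcomb _ _ _ SS linF bS FJ) entry mulr_sumr; apply: eq_bigr => i _.
  by rewrite mulr_sumr; apply: eq_bigr => j _; rewrite mulrCA.
have [w wE] := basis_dual bS.
pose nw i := \sum_c \sum_d `|w i c d|.
pose nb j := \sum_a \sum_e `|b j a e|.
have nw0 i : 0 <= nw i by do 2!apply: sumr_ge0 => ? _.
have nb0 i : 0 <= nb i by do 2!apply: sumr_ge0 => ? _.
(* Entries of [J ^+ k] are pairings of the dual functionals with [F^k (b j)], whose entries are at
   most [nb j] times the trace. *)
exists (\sum_i \sum_j nw i * nb j).
  by do 2!apply: sumr_ge0 => ? _; apply: mulr_ge0.
move=> k k0; split; first by rewrite invr_ge0 maxabs_ge0.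
rewrite mulrCA mulrC ler_pdivlMr // mul1r.
have [T [K [FK _]]] := @fkraus_iter (fun=> True) F _ A k (fun _ _ _ _ => I) (fun=> I) FA k0.
have t0 : 0 <= diag_trace (iter k F).
  rewrite /diag_trace; do 2!apply: sumr_ge0 => ? _.
  rewrite (fkraus_entry _ _ _ _ FK); apply: sumr_ge0 => i _.
  by rewrite mulrC -normCK exprn_ge0.
have linFk : lin_on (fun=> True) (iter k F).
  by move=> a X Y _ _; elim: (k) => //= k' ->; rewrite linF.
have Jk i j : (J ^+ k) i j = pairing (w i) (iter k F (b j)).
  suff -> : J ^+ k = \matrix_(i, j) pairing (w i) (iter k F (b j)) by rewrite mxE.
  apply: (mcomb_inj bS) => j'; rewrite -[LHS]JP [LHS]wE //.
  by apply: eq_bigr => i' _; rewrite mxE.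
have le_entry j c d : `|(iter k F (b j)) c d| <= nb j * diag_trace (iter k F).
  rewrite [in leLHS](matrix_sum_delta (b j)) pair_bigA /=.
  rewrite (lin_on_sum _ SS linFk (fun=> I)) summxE /nb pair_bigA /= mulr_suml.
  apply: le_trans (ler_norm_sum _ _ _) _; apply: ler_sum => e _.
  by rewrite mxE normrM ler_wpM2l // (ler_norm_fkraus _ _ _ _ FK).
apply: maxabs_le => [|i j]; first by rewrite mulr_ge0 //; do 2!apply: sumr_ge0 => ? _; apply: mulr_ge0.
apply: (@le_trans _ _ (nw i * nb j * diag_trace (iter k F))).
  rewrite Jk /pairing /nw -mulrA mulr_suml.
  apply: le_trans (ler_norm_sum _ _ _) _; apply: ler_sum => c _.
  rewrite mulr_suml.
  apply: le_trans (ler_norm_sum _ _ _) _; apply: ler_sum => d _.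
  by rewrite normrM ler_wpM2l.
rewrite ler_wpM2r //; apply: le_trans (ler_sum_ge0 i _) => [|i'].
  by apply: (@ler_sum_ge0 _ _ (fun j => nw i * nb j)) => j'; apply: mulr_ge0.
by apply: sumr_ge0 => j' _; apply: mulr_ge0.
Qed.

(** If all [B j] were 0, then [G = 0] and the weighted averages of the traces would tend to 0,
    although [s] times them is at least 1. *)
Lemma maxpart_span_nonzero : exists2 X, span_of B X & X != 0.
Proof.
have [m mG [s s0 ms]] := maxpart_weights.
apply: contrapT => h.
have B0 j : B j = 0.
  by apply: contrapT => /eqP Bj; apply: h; exists (B j) => //; apply: span_mem.
have G0 X : G X = 0 by rewrite GB big1 // => j _; rewrite B0 mulmx0.
have cv : cvgs (fun K => s * \sum_a \sum_c avg (fun k => m k * (iter k F (delta_mx a a)) c c) K) 0.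
  have h1 : cvgs (fun K => \sum_a \sum_c avg (fun k => m k * (iter k F (delta_mx a a)) c c) K)
    (\sum_a \sum_c G (delta_mx a a) c c) by do 2!apply: cvgs_sum => ?; apply: mG.
  have := cvgsMl s h1; rewrite [\sum_a _]big1 ?mulr0 // => a _.
  by rewrite big1 // => c _; rewrite G0 mxE.
have [K0 /(_ K0.+1 (leqnSn _))] := cv 1 ltr01; rewrite subr0.
have ge1 : 1 <= s * \sum_a \sum_c avg (fun k => m k * (iter k F (delta_mx a a)) c c) K0.+1.
  under eq_bigr do rewrite -avg_sum.
  rewrite -avg_sum -avgMl -[leLHS](avg_cst _ (ltn0Sn K0)); apply: avg_le => k k0.
  have [_] := ms k k0; rewrite /diag_trace mulr_sumr => /le_trans; apply.
  by under eq_bigr do rewrite mulr_sumr.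
by rewrite ger0_norm ?(le_trans _ ge1) // => /(le_lt_trans ge1); rewrite ltxx.
Qed.

(** A functional vanishing on the generated algebra is a zero of the Choi form of each [F^k] with
    [k > 0]; by averaging and passing to the limit it is a zero for [G]. *)
Lemma maxpart_span_gen_alg X : span_of B X -> gen_alg A X.
Proof.
have [m mG _] := maxpart_weights.
have [S0 SD SM] := gen_alg_subalg A.
apply: span_sub; first by split.
move=> j; apply: subspace_annihilator; first by split.
move=> z zA; apply: (choi_form_eq0 (GB : fkraus G B)).
apply: esym; apply: cvgs_cst_eq.
have h : cvgs (fun K => \sum_a \sum_c \sum_b \sum_d ((z a c)^* * z b d) *
    avg (fun k => m k * (iter k F (delta_mx a b)) c d) K) (choi_form G z).
  by do 4!apply: cvgs_sum => ?; apply: cvgsMl.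
apply: (cvgs_ext _ h) => K.
under [RHS]eq_bigr do under eq_bigr do under eq_bigr do under eq_bigr do rewrite -avgMl.
under [RHS]eq_bigr do under eq_bigr do under eq_bigr do rewrite -avg_sum.
under [RHS]eq_bigr do under eq_bigr do rewrite -avg_sum.
under [RHS]eq_bigr do rewrite -avg_sum.
rewrite -avg_sum; transitivity (avg (fun=> 0 : C) K); first by rewrite /avg big1 ?mulr0.
apply: avg_eq => k k0.
have [T [K' [FK' AK']]] := fkraus_iter SM (@gen_alg_mem _ A) FA k0.
have Q0 : choi_form (iter k F) z = 0.
  by rewrite (choi_form_kraus _ FK') big1 // => i _; rewrite zA ?normr0 ?expr0n.
transitivity (m k * choi_form (iter k F) z); first by rewrite Q0 mulr0.
rewrite /choi_form; do 4!(rewrite mulr_sumr; apply: eq_bigr => ? _).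
exact: mulrCA.
Qed.

Lemma maxpart_span_ideal : is_subalg (span_of B) /\ is_ideal_in (gen_alg A) (span_of B).
Proof.
have [V0 VD] := span_subspace B.
(* The products [B j *m A i] are Kraus operators of [F \o G] and the products [A i *m B j] of
   [G \o F]; both maps equal [r] times [G]. *)
have BA i j : span_of B (B j *m A i).
  have := fkraus_span (i, j) (GB : fkraus G B) (fkraus_comp (FA : fkraus F A) (GB : fkraus G B)) FG.
  exact.
have AB i j : span_of B (A i *m B j).
  have := fkraus_span (j, i) (GB : fkraus G B) (fkraus_comp (GB : fkraus G B) (FA : fkraus F A)) GF.
  exact.
(* The two-sided multipliers of the span form a subalgebra containing every [A i], hence the
   generated algebra. *)
pose T a := forall v, span_of B v -> span_of B (a *m v) /\ span_of B (v *m a).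
have TS : is_subalg T.
  split=> [v _|a X Y TX TY v Bv|X Y TX TY v Bv]; first by rewrite mul0mx mulmx0; split.
    have [[? ?] [? ?]] := (TX v Bv, TY v Bv).
    by rewrite mulmxDl mulmxDr -scalemxAl -scalemxAr; split; apply: VD.
  rewrite -(mulmxA X Y v) (mulmxA v X Y); split; first by case: (TX _ (proj1 (TY _ Bv))).
  by case: (TY _ (proj2 (TX _ Bv))).
have TA i : T (A i).
  move=> _ [c ->]; split.
    rewrite /lincomb mulmx_sumr; under eq_bigr do rewrite -scalemxAr.
    exact: subspace_sum.
  rewrite /lincomb mulmx_suml; under eq_bigr do rewrite -scalemxAl.
  exact: subspace_sum.
have ideal : is_ideal_in (gen_alg A) (span_of B).
  split; first exact: maxpart_span_gen_alg.
  by move=> a v ga; apply: (ga T TS TA v).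
(* Closure under products is the ideal property applied to a factor which itself lies in the
   generated algebra. *)
split=> //; split=> // X Y BX BY.
by have [_ /(_ _ _ (maxpart_span_gen_alg BX) BY)[]] := ideal.
Qed.
End MaxPart.
End Kraus.

(** * The block-diagonal algebra *)

Lemma complex_archimedean (R : realType) (x : R[i]) : exists n : nat, `|x| < n%:R.
Proof.
exists (Num.bound (complex.Re `|x|)).

rewrite -(RRe_real (normr_real x)) -(rmorph_nat (real_complex R)) ltcR.
by apply: archi_boundP; have := normr_ge0 x; rewrite lecE => /andP[].
Qed.

Section BlockAlg.
Variables (C : numClosedFieldType) (d : nat) (n : 'I_d -> nat).
Local Notation m := (\sum_(k < d) n k)%N.

Lemma blockalg_bdpart (X : 'M[C]_m) : blockalg n (bdpart n X).
Proof. by exists (fun k => submxblock X k k). Qed.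

Lemma bdpart_id (X : 'M[C]_m) : blockalg n X -> bdpart n X = X.
Proof. by move=> [B ->]; apply: eq_mxdiag => k; rewrite submxblock_diag. Qed.

Lemma mxdiag_lin a (B B' : forall k, 'M[C]_(n k)) :
  mxdiag (fun k => a *: B k + B' k) = a *: mxdiag B + mxdiag B'.
Proof.
apply/matrixP => i j; rewrite !mxE.
move: (tagnat.sig2 i) (tagnat.sig2 j); move: (tagnat.sig1 i) (tagnat.sig1 j) => x y u v.
case: eqVneq v => [<-|_] v; last by rewrite !mxE mulr0 addr0.
by rewrite !conform_mx_id !mxE.
Qed.

Lemma blockalg_subspace : subspace (@blockalg C d n).
Proof.
split; first by exists (fun k => 0); rewrite mxdiag0.
by move=> a _ _ [B ->] [B' ->]; exists (fun k => a *: B k + B' k); rewrite mxdiag_lin.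
Qed.

Lemma bdpart_lin : lin_on (fun=> True) (@bdpart C d n).
Proof.
move=> a X Y _ _; rewrite /bdpart -mxdiag_lin; apply: eq_mxdiag => k.
by apply/matrixP => i j; rewrite !mxE.
Qed.
End BlockAlg.

(** * Maximal parts of a map on the block-diagonal algebra and of its canonical extension *)

Unset Implicit Arguments.

Theorem theorem5p15 (R : realType) (d : nat) (n : 'I_d -> nat)
  (n_gt0 : forall k, (0 < n k)%N)
  (tau : 'M[R[i]]_(\sum_(k < d) n k) -> 'M[R[i]]_(\sum_(k < d) n k)) :
  (forall X, blockalg n X -> blockalg n (tau X)) ->
  lin_on (blockalg n) tau ->
  cp_on (blockalg n) tau ->
  (exists2 r, specrad (blockalg n) tau r & 0 < r) ->
  exists tauhat : 'M[R[i]]_(\sum_(k < d) n k) -> 'M[R[i]]_(\sum_(k < d) n k),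
    [/\ maxpart (blockalg n) tau tauhat,
        maxpart (fun _ => True) (canext n tau) (canext n tauhat) &
        forall p (A : 'I_p -> 'M[R[i]]_(\sum_(k < d) n k))
               q (B : 'I_q -> 'M[R[i]]_(\sum_(k < d) n k)),
          kraus (canext n tau) A -> kraus (canext n tauhat) B ->
          [/\ is_subalg (span_of B),
              is_ideal_in (gen_alg A) (span_of B) &
              exists2 X, span_of B X & X != 0]].
Proof.
move=> Stau ltau _ [rho [[l [X0 [SX0 X00 tauX0]] lrho] _] rho0].
have l0 : l != 0 by rewrite -normr_gt0 lrho.
have archC := @complex_archimedean R.
have SS := @blockalg_subspace R[i] d n; have ST := @subspaceT R[i] (\sum_(k < d) n k).
have [D [b [J [bS tauJ jJ]]]] := jordan_basis_exists SS ltau Stau.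
have Sb : forall i, blockalg n (b i) by case: bS.
have coords X : blockalg n X -> exists x : 'cV[R[i]]_D, X = mcomb b x 0.
  by move=> SX; have [x xE] := basis_mcomb bS (fun _ : 'I_1 => SX); exists x; apply: (xE 0).
(* With zero diagonal [J] would be nilpotent, while [tau^k X0 = l^k X0] never vanishes. *)
have [i0 Ji0] : exists i0, J i0 i0 != 0.
  apply: contrapT => /forallNP h.
  have Jn : J ^+ D.+1 = 0.
    by apply: jordan_nilpotent => // i; apply: contrapT => /eqP; apply: h.
  have [x xE] := coords _ SX0.
  have iterX0 k : iter k tau X0 = l ^+ k *: X0.
    elim: k => [|k IH]; first by rewrite expr0 scale1r.
    have [S0 _] := SS.
    have tau0 : tau 0 = 0.
      by have := lin_on_sum (fun=> 0) (F := fun _ : 'I_0 => X0) SS ltau (fun _ => SX0); rewrite !big_ord0.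
    by rewrite iterS IH -[_ *: X0]addr0 ltau // tau0 addr0 tauX0 scalerA exprSr.
  have := iterX0 D.+1; rewrite {1}xE (iter_mcomb _ _ _ SS ltau bS tauJ) Jn mul0mx.
  rewrite [mcomb _ _ _]big1 => [/esym/eqP|i _]; last by rewrite mxE scale0r.
  by rewrite scaler_eq0 expf_eq0 (negPf l0) andbF (negPf X00).
have [r [t [L [r0 [N0 mJ] cL JL LJ]]]] := jordan_cesaro archC jJ Ji0.
have [w wE] := basis_dual bS.
pose crd X : 'cV[R[i]]_D := \col_j pairing (w j) X.
have crdE X : blockalg n X -> X = mcomb b (crd X) 0.
  by move=> SX; rewrite {1}(wE _ SX); apply: eq_bigr => j _; rewrite mxE.
have crdK (x : 'cV[R[i]]_D) : crd (mcomb b x 0) = x.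
  apply: (mcomb_inj bS) => j; rewrite (ord1 j) -crdE //.
  exact: mcomb_mem.
(* The map with matrix [L] in the basis [b]; the dual functionals make it a total function on
   matrices, with block-diagonal values. *)
pose tauhat X := mcomb b (L *m crd X) 0.
have tauhatE (x : 'cV[R[i]]_D) : tauhat (mcomb b x 0) = mcomb b (L *m x) 0 by rewrite /tauhat crdK.
have Stauhat X : blockalg n (tauhat X) by apply: mcomb_mem.
have mcomb_lin a (x y : 'cV[R[i]]_D) : mcomb b (a *: x + y) 0 = a *: mcomb b x 0 + mcomb b y 0.
  rewrite /mcomb scaler_sumr -big_split; apply: eq_bigr => i _.
  by rewrite !mxE scalerDl scalerA.
have ltauhat : lin_on (blockalg n) tauhat.
  move=> a X Y /coords[x ->] /coords[y ->].
  by rewrite -mcomb_lin !tauhatE mulmxDr -scalemxAr mcomb_lin.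
have bE j : b j = mcomb b (delta_mx j 0 : 'cV[R[i]]_D) 0.
  by rewrite -{1}[b j]mcomb1; apply: eq_bigr => i _; rewrite !mxE eqxx andbT.
have tauhatL : mx_in_basis b tauhat L.
  move=> j; rewrite {1}(bE j) tauhatE -colE.
  by apply: eq_bigr => i _; rewrite mxE.
have tauE (x : 'cV[R[i]]_D) : tau (mcomb b x 0) = mcomb b (J *m x) 0.
  exact: lin_on_mcomb SS ltau Sb tauJ.
have mcombZ (x : 'cV[R[i]]_D) : mcomb b (r *: x) 0 = r *: mcomb b x 0.
  by rewrite /mcomb scaler_sumr; apply: eq_bigr => i _; rewrite mxE scalerA.
have tt X : blockalg n X -> tau (tauhat X) = r *: tauhat X.
  by move=> /coords[x ->]; rewrite tauhatE tauE mulmxA JL -scalemxAl mcombZ.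
have tt' X : blockalg n X -> tauhat (tau X) = r *: tauhat X.
  by move=> /coords[x ->]; rewrite tauE !tauhatE mulmxA LJ -scalemxAl mcombZ.
have Jb : jordan_basis (blockalg n) tau b J by split.
have bd := @blockalg_bdpart R[i] d n; have bdid := @bdpart_id R[i] d n.
(* The canonical extension is composition with the projection [bdpart n] of all matrices onto the
   block-diagonal ones. *)
have maxF : maxpart (fun=> True) (canext n tau) (canext n tauhat).
  exact: (maxpart_proj (phi := bdpart n) archC SS ST (fun _ _ => I) (@bdpart_lin _ d n)
    (fun X _ => bd X) bdid ltau Stau ltauhat tauhatL Jb r0 mJ cL).
exists tauhat; split=> //.
  exact: (maxpart_proj (phi := id) archC SS SS (fun _ => id) (fun _ _ _ _ _ => erefl)
    (fun _ => id) (fun _ _ => erefl) ltau Stau ltauhat tauhatL Jb r0 mJ cL).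
move=> p A q B FA GB.
have linF : lin_on (fun=> True) (canext n tau).
  by move=> a X Y _ _; rewrite /canext bdpart_lin // ltau.
(* Values of [tau] and [tauhat] on block-diagonal matrices are block-diagonal, so [bdpart] fixes
   them and the relations on the algebra pass to the extensions. *)
have FG X : canext n tau (canext n tauhat X) = r *: canext n tauhat X.
  by rewrite /canext [bdpart n (tauhat _)]bdid ?tt.
have GF X : canext n tauhat (canext n tau X) = r *: canext n tauhat X.
  by rewrite /canext [bdpart n (tau _)]bdid ?tt' //; apply: Stau.
have FX0 : canext n tau X0 = l *: X0 by rewrite /canext bdid.
have [VS VI] := maxpart_span_ideal linF maxF FG GF X00 l0 FX0 FA GB.
split=> //; exact: maxpart_span_nonzero linF maxF X00 l0 FX0 FA GB.
Qed.
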